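(* Let $n\ge 2$, let $a\in\mathbb{C}$ with $|a|\neq 0,1$, and let $b=\min\sigma(\mathrm{Re}\,J_n(a))$. Then for any $j$, $1\le j\le n$, $$\partial W(J_n(a))\cap\partial W(J_n(a)[j])=\begin{cases}\{b\} & \text{if } n \text{ is odd},\ j=(n+1)/2,\ \text{and } |a|>1,\\ \emptyset & \text{otherwise.}\end{cases}$$ Moreover, when $b$ is in this intersection, there is a unit vector $x=[x_1\ \ldots\ x_{j-1}\ 0\ -x_{j-1}\ \ldots\ -x_1]^T$ in $\mathbb{C}^n$ such that $(\mathrm{Re}\,J_n(a))x=bx$ and $\langle J_n(a)x,x\rangle=b$.
   Context: For $n\ge 1$ and $a\in\mathbb{C}$, the KMS matrix $J_n(a)$ is the $n\times n$ strictly upper-triangular matrix whose $(i,j)$ entry is $a^{j-i}$ if $i<j$ and $0$ if $i\ge j$. For an $n\times n$ complex matrix $A$: $W(A)=\{\langle Ax,x\rangle: x\in\mathbb{C}^n,\ \|x\|=1\}$ is its numerical range, where $\langle\cdot,\cdot\rangle$ is the standard inner product and $\|\cdot\|$ its norm, and $\partial W(A)$ is the boundary of $W(A)$ in $\mathbb{C}$; $\mathrm{Re}\,A=(A+A^* )/2$; $\sigma(A)$ is the spectrum; and, for $n\ge 2$ and $1\le j\le n$, $A[j]$ is the $(n-1)\times(n-1)$ principal submatrix obtained by deleting the $j$th row and $j$th column of $A$.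
   Formalization: The ''Moreover'' fails for non-real a (e.g. n=3, j=2, a=2i, where b=-2 has eigenvector [1 0 1]^T); it is proved as printed for real a, and for complex a with x replaced by Dx, where D=diag(1,w,…,w^{n-1}) and w=conj(a)/|a|. *)

(* Defs.v *)
From mathcomp Require Import all_boot all_order all_algebra.
From mathcomp Require Import complex.
From mathcomp Require Import all_classical all_reals all_analysis.

Set Implicit Arguments.
Unset Strict Implicit.
Unset Printing Implicit Defensive.

Import Order.TTheory GRing.Theory Num.Theory.
Import numFieldNormedType.Exports.

Local Open Scope classical_set_scope.
Local Open Scope ring_scope.
Local Open Scope sesquilinear_scope.

(* [C] is abstract so that the norm topology of mathcomp-analysis, declared on
   numeric fields, is inferred; the intended instance is [C := R[i]] for
   [R : realType]. *)
Section NumericalRange.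
Context {C : numClosedFieldType}.

Definition boundary (A : set C) : set C := closure A `\` interior A.

(* [dotmx] takes row vectors: this is \sum_i x_i (y_i)^*. *)
Definition cdot n (x y : 'cV[C]_n) : C := dotmx x^T y^T.

Definition cnorm n (x : 'cV[C]_n) : C := sqrtC (cdot x x).

Definition numerical_range n (A : 'M[C]_n) : set C :=
  [set cdot (A *m x) x | x in [set x : 'cV[C]_n | cnorm x = 1]].

Definition re_mx n (A : 'M[C]_n) : 'M[C]_n := 2^-1 *: (A + A ^t*).

Definition spectrum n (A : 'M[C]_n) : set C := [set c | eigenvalue A c].

(* The order of [C] only compares numbers with the same imaginary part, so
   this is the usual minimum on a set of real numbers. *)
Definition is_min (S : set C) (b : C) : Prop :=
  S b /\ forall c, S c -> b <= c.

Definition principal_submx n (A : 'M[C]_n) (j : 'I_n) : 'M[C]_n.-1 :=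
  col' j (row' j A).

End NumericalRange.

Section KMS.
Context {C : numClosedFieldType}.

Definition KMS n (a : C) : 'M[C]_n :=
  \matrix_(i, j) if (i < j)%N then a ^+ (j - i) else 0.

(* x = [x_1 ... x_(j-1) 0 -x_(j-1) ... -x_1]^T; [rev_ord j = j] says that the
   index [j] is the middle one, as the shape of the vector requires. *)
Definition skew_about n (j : 'I_n) (x : 'cV[C]_n) : Prop :=
  [/\ rev_ord j = j, x j 0 = 0 &
      forall i : 'I_n, (i < j)%N -> x (rev_ord i) 0 = - x i 0].

(* The diagonal unitary D with KMS n a = D *m KMS n `|a| *m D ^t*. If y is an
   eigenvector of re_mx (KMS n `|a|), then D *m y is one of re_mx (KMS n a) for
   the same eigenvalue; D cannot be dropped in general: for n = 3 and a = 2i,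
   the eigenvector for the least eigenvalue -2 is [1 0 1]^T up to a factor. *)
Definition phase_mx n (a : C) : 'M[C]_n :=
  diag_mx (\row_(k < n) (a^* / `|a|) ^+ k).

End KMS.

(* Main.v *)
Require Import Defs.
From mathcomp Require Import all_boot all_order all_algebra.
From mathcomp Require Import complex.
From mathcomp Require Import all_classical all_reals all_analysis.
From mathcomp Require Import zify ring lra.

Import Order.TTheory GRing.Theory Num.Theory.
Import numFieldNormedType.Exports.
Local Open Scope classical_set_scope.
Local Open Scope ring_scope.

(* Conjugation by a diagonal unitary replaces a by r = |a|. A common boundary
   point p is <Jx, x> for a unit vector x with x_j = 0, and, W(J) being convex
   (Toeplitz-Hausdorff), p lies on a supporting line: for some |w| = 1 the form
   S = lam |x|^2 - Re (w <Jx, x>) is nonnegative and S(x) = 0. A nonnegative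
   quadratic form is invariant under translation by its zeros, so the zeros of S
   can be modified freely. Because the entries of J are powers of r, the two
   arms u, v of x on either side of j interact only through two scalars s, t
   (their weighted sums towards j), and row j gives w^* s + w t = 0. Rotating v
   against u forces w = -1, hence t = -s, unless s = t = 0. A zero of S with a
   zero first or last entry vanishes: this excludes s = t = 0, and, applied to
   (u, 0, -u) padded with zeros, it forces the arms to have equal lengths. Then
   (u, -2s, u) excludes r < 1. For r > 1 and n odd, completing the square in the
   middle entry turns a symmetric minimizer (u, c, u) into the skew one
   (u, 0, -u). *)

Set Implicit Arguments.
Unset Strict Implicit.
Unset Printing Implicit Defensive.

Local Open Scope sesquilinear_scope.
Local Notation "x %:C" := (real_complex _ x) : ring_scope.
Local Notation Re := complex.Re.
Local Notation Im := complex.Im.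

(** * Real and imaginary parts, squared modulus *)

Section ComplexParts.
Context {R : rcfType}.
Implicit Types (x y : R[i]) (r : R).

Lemma ReD x y : Re (x + y) = Re x + Re y. Proof. by case: x; case: y. Qed.
Lemma ImD x y : Im (x + y) = Im x + Im y. Proof. by case: x; case: y. Qed.
Lemma ReN x : Re (- x) = - Re x. Proof. by case: x. Qed.
Lemma ImN x : Im (- x) = - Im x. Proof. by case: x. Qed.
Lemma ReM x y : Re (x * y) = Re x * Re y - Im x * Im y.
Proof. by case: x; case: y. Qed.
Lemma ImM x y : Im (x * y) = Re x * Im y + Im x * Re y.
Proof. by case: x; case: y. Qed.
Lemma ReJ x : Re (Num.conj x) = Re x. Proof. by case: x. Qed.
Lemma ImJ x : Im (Num.conj x) = - Im x. Proof. by case: x. Qed.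

Definition cE := (ReD, ImD, ReN, ImN, ReM, ImM, ReJ, ImJ).

Lemma complexP x y : Re x = Re y -> Im x = Im y -> x = y.
Proof. by case: x; case: y => /= ? ? ? ? -> ->. Qed.

Lemma conj_realC r : (r%:C)^* = r%:C :> R[i].
Proof. exact: conjc_real. Qed.

(** The squared modulus, valued in [R] so that identities and inequalities become real polynomial
    arithmetic. *)
Definition sqn x : R := Re x ^+ 2 + Im x ^+ 2.

Lemma sqn_ge0 x : 0 <= sqn x.
Proof. by rewrite addr_ge0 ?sqr_ge0. Qed.

Lemma sqn_eq0 x : sqn x = 0 -> x = 0.
Proof.
move/eqP; rewrite paddr_eq0 ?sqr_ge0 // !sqrf_eq0 => /andP[/eqP h /eqP k].
exact: complexP.
Qed.

Lemma sqnN x : sqn (- x) = sqn x.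
Proof. by rewrite /sqn !cE !sqrrN. Qed.

Lemma sqn0 : sqn 0 = 0.
Proof. by rewrite /sqn /= expr0n addr0. Qed.

End ComplexParts.

(** * The quadratic form of a KMS matrix *)

Section Form.
Context {R : rcfType} (a : R).
Implicit Types (x y u v : nat -> R[i]) (c z w : R[i]) (n l r k : nat).

Definition mirror n x : nat -> R[i] := fun k => x (n - k.+1)%N.
(** The entries before position [n] act on entry [n] only through this scalar; [right_sum] is its
    mirror image. *)
Definition left_sum n x : R[i] := \sum_(i < n) (a ^+ (n - i))%:C * x i.
Definition right_sum n x : R[i] := \sum_(i < n) (a ^+ i.+1)%:C * x i.
(** This is <Jx, x> for the real parameter [a], summed column by column. Vectors are sequences on
    [nat], so that they can be cut, reversed and padded while the length is a separate argument. *)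
Definition kms_form n x : R[i] := \sum_(k < n) x k * (left_sum k x)^*.
Definition sqnorm n x : R := \sum_(k < n) sqn (x k).

Lemma eq_left_sum n x y : (forall k, (k < n)%N -> x k = y k) ->
  left_sum n x = left_sum n y.
Proof. by move=> e; apply: eq_bigr => i _; rewrite e. Qed.

Lemma eq_form n x y : (forall k, (k < n)%N -> x k = y k) -> kms_form n x = kms_form n y.
Proof.
move=> e; apply: eq_bigr => i _; rewrite e // (@eq_left_sum _ x y) // => k ki.
by apply: e; apply: ltn_trans ki _.
Qed.

Lemma eq_sqnorm n x y : (forall k, (k < n)%N -> x k = y k) -> sqnorm n x = sqnorm n y.
Proof. by move=> e; apply: eq_bigr => i _; rewrite e. Qed.

Lemma eq_right_sum n x y : (forall k, (k < n)%N -> x k = y k) ->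
  right_sum n x = right_sum n y.
Proof. by move=> e; apply: eq_bigr => i _; rewrite e. Qed.

Lemma mirrorK n x k : (k < n)%N -> mirror n (mirror n x) k = x k.
Proof. by move=> kn; rewrite /mirror; congr x; lia. Qed.

Lemma left_sum0 x : left_sum 0 x = 0. Proof. by rewrite /left_sum big_ord0. Qed.

Lemma left_sumS n x : left_sum n.+1 x = a%:C * (left_sum n x + x n).
Proof.
rewrite /left_sum big_ord_recr /= subSnn expr1 mulrDr mulr_sumr; congr (_ + _).
apply: eq_bigr => i _; rewrite mulrA -rmorphM -exprS subSn //.
by apply: ltnW; apply: ltn_ord.
Qed.

Lemma form0 x : kms_form 0 x = 0. Proof. by rewrite /kms_form big_ord0. Qed.
Lemma formS n x : kms_form n.+1 x = kms_form n x + x n * (left_sum n x)^*.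
Proof. by rewrite /kms_form big_ord_recr. Qed.
Lemma sqnorm0 x : sqnorm 0 x = 0. Proof. by rewrite /sqnorm big_ord0. Qed.
Lemma sqnormS n x : sqnorm n.+1 x = sqnorm n x + sqn (x n).
Proof. by rewrite /sqnorm big_ord_recr. Qed.

Lemma sqnorm_ge0 n x : 0 <= sqnorm n x.
Proof. by apply: sumr_ge0 => i _; apply: sqn_ge0. Qed.

Lemma sqnorm_eq0 n x : sqnorm n x = 0 -> forall k, (k < n)%N -> x k = 0.
Proof.
elim: n => // n IH; rewrite sqnormS => /eqP.
rewrite paddr_eq0 ?sqnorm_ge0 ?sqn_ge0 // => /andP[/eqP h /eqP h'] k.
by rewrite ltnS leq_eqVlt => /orP[/eqP -> | /IH -> //]; apply: sqn_eq0.
Qed.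

Lemma right_sum0 x : right_sum 0 x = 0. Proof. by rewrite /right_sum big_ord0. Qed.
Lemma right_sumS n x : right_sum n.+1 x = right_sum n x + (a ^+ n.+1)%:C * x n.
Proof. by rewrite /right_sum big_ord_recr. Qed.

Lemma right_sum_mirror n x : right_sum n (mirror n x) = left_sum n x.
Proof.
rewrite /left_sum (reindex_inj rev_ord_inj) /=; apply: eq_bigr => i _.
rewrite /mirror /= subKn //; exact: ltn_ord.
Qed.

Lemma left_sum_mirror n x : left_sum n (mirror n x) = right_sum n x.
Proof.
rewrite -right_sum_mirror; apply: eq_right_sum; exact: mirrorK.
Qed.

Lemma sqnorm_mirror n x : sqnorm n (mirror n x) = sqnorm n x.
Proof. by rewrite /sqnorm [RHS](reindex_inj rev_ord_inj). Qed.

Lemma left_sum_cut l r x :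
  left_sum (l + r.+1) x = (a ^+ r.+1)%:C * (left_sum l x + x l)
                        + left_sum r (fun k => x (l + k.+1)%N).
Proof.
elim: r => [|r IH]; first by rewrite addn1 left_sumS expr1 left_sum0 addr0.
rewrite addnS left_sumS IH left_sumS [a ^+ r.+2]exprS rmorphM /=; ring.
Qed.

Lemma sqnorm_cut l r x :
  sqnorm (l + r.+1) x = sqnorm l x + sqn (x l) + sqnorm r (fun k => x (l + k.+1)%N).
Proof.
elim: r => [|r IH]; first by rewrite addn1 sqnormS sqnorm0 addr0.
rewrite addnS sqnormS IH sqnormS; ring.
Qed.

(** For i < l < k the weight a^(k-i) factors as a^(k-l) a^(l-i), so the block coupling the two sides
    of position l has rank one. *)
Lemma form_cut l r x (v := fun k => x (l + k.+1)%N) :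
  kms_form (l + r.+1) x = kms_form l x + kms_form r v + x l * (left_sum l x)^*
     + right_sum r v * (x l)^* + right_sum r v * (left_sum l x)^*.
Proof.
rewrite /v; elim: r => [|r IH].
  by rewrite addn1 formS form0 right_sum0 !mul0r !addr0.
rewrite addnS formS IH formS right_sumS left_sum_cut -/v.
have -> : ((a ^+ r.+1)%:C * (left_sum l x + x l) + left_sum r v)^* =
   (a ^+ r.+1)%:C * ((left_sum l x)^* + (x l)^*) + (left_sum r v)^*.
  rewrite rmorphD rmorphM /= rmorphD /=; congr (_ * _ + _).
  exact: conjc_real.
rewrite /v; ring.
Qed.

(** Reversing the coordinates transposes the matrix, and for real [a] the transpose is the
    adjoint. *)
Lemma form_mirror n x : kms_form n (mirror n x) = (kms_form n x)^*.
Proof.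
elim: n x => [|n IH] x; first by rewrite !form0 rmorph0.
have := @form_cut 0 n (mirror n.+1 x); rewrite add0n => ->.
rewrite form0 left_sum0 rmorph0 !mulr0 !addr0 add0r formS [RHS]rmorphD rmorphM /= conjCK.
rewrite -IH -right_sum_mirror mulrC; congr (_ + _ * _).
by rewrite /mirror subn1.
Qed.

Lemma left_sumD n x y (t : R) :
  left_sum n (fun k => x k + t%:C * y k) = left_sum n x + t%:C * left_sum n y.
Proof.
rewrite /left_sum mulr_sumr -big_split /=; apply: eq_bigr => i _; ring.
Qed.

(** The value of the cross term is irrelevant: positivity eliminates it in [defect_shift]. *)
Lemma formD n x y : exists c, forall t : R,
  kms_form n (fun k => x k + t%:C * y k)
    = kms_form n x + t%:C * c + (t ^+ 2)%:C * kms_form n y.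
Proof.
exists (\sum_(k < n) (x k * (left_sum k y)^* + y k * (left_sum k x)^*)) => t.
rewrite /kms_form !mulr_sumr -!big_split /=; apply: eq_bigr => i _.
rewrite left_sumD rmorphD rmorphM /= conj_realC expr2 rmorphM /=; ring.
Qed.

Lemma sqnormD n x y : exists c : R, forall t : R,
  sqnorm n (fun k => x k + t%:C * y k) = sqnorm n x + t * c + t ^+ 2 * sqnorm n y.
Proof.
exists (\sum_(k < n) (2 * (Re (x k) * Re (y k) + Im (x k) * Im (y k)))) => t.
rewrite /sqnorm !mulr_sumr -!big_split /=; apply: eq_bigr => i _.
by rewrite /sqn !cE /=; ring.
Qed.

Lemma left_sumZ n x c : left_sum n (fun k => c * x k) = c * left_sum n x.
Proof. by rewrite /left_sum mulr_sumr; apply: eq_bigr => i _; ring. Qed.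

Lemma right_sumZ n x c : right_sum n (fun k => c * x k) = c * right_sum n x.
Proof. by rewrite /right_sum mulr_sumr; apply: eq_bigr => i _; ring. Qed.

Lemma formZ n x c : kms_form n (fun k => c * x k) = (sqn c)%:C * kms_form n x.
Proof.
rewrite /kms_form mulr_sumr; apply: eq_bigr => i _.
rewrite left_sumZ; apply: complexP; rewrite /sqn !cE /=; ring.
Qed.

Lemma sqnormZ n x c : sqnorm n (fun k => c * x k) = sqn c * sqnorm n x.
Proof.
rewrite /sqnorm mulr_sumr; apply: eq_bigr => i _.
by rewrite /sqn !cE; ring.
Qed.

Lemma right_sum_zero n x : (forall k, (k < n)%N -> x k = 0) -> right_sum n x = 0.
Proof. by move=> e; rewrite /right_sum big1 // => i _; rewrite e // mulr0. Qed.

Lemma form_const0 n : kms_form n (fun=> 0) = 0.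
Proof. by rewrite /kms_form big1 // => i _; rewrite mul0r. Qed.
Lemma sqnorm_const0 n : sqnorm n (fun=> 0) = 0.
Proof. by rewrite /sqnorm big1 // => i _; rewrite sqn0. Qed.
Lemma right_sum_const0 n : right_sum n (fun=> 0) = 0.
Proof. exact: right_sum_zero. Qed.

Definition const0E := (form_const0, sqnorm_const0, right_sum_const0).

(* u and v are both indexed by the distance to the middle entry c. *)
Definition arms l u c v : nat -> R[i] := fun k =>
  if (k < l)%N then u (l - k.+1)%N else
  if k == l then c else v (k - l.+1)%N.

Lemma armsL l u c v k : (k < l)%N -> arms l u c v k = mirror l u k.
Proof. by move=> kl; rewrite /arms kl. Qed.
Lemma armsM l u c v : arms l u c v l = c.
Proof. by rewrite /arms ltnn eqxx. Qed.
Lemma armsR l u c v k : arms l u c v (l + k.+1)%N = v k.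
Proof.
rewrite /arms ltnNge leq_addr /= -[X in _ == X]addn0 eqn_add2l /=.
by congr v; lia.
Qed.

Lemma arms_split l r x k : (k < l + r.+1)%N ->
  x k = arms l (mirror l x) (x l) (fun s => x (l + s.+1)%N) k.
Proof.
move=> kn; rewrite /arms; case: ltnP => [kl|lk]; first by rewrite /mirror; congr x; lia.
by case: eqP => [->//|kl]; congr x; lia.
Qed.

Lemma form_arms l r u c v : kms_form (l + r.+1) (arms l u c v) =
  (kms_form l u)^* + kms_form r v + c * (right_sum l u)^* + right_sum r v * c^*
  + right_sum r v * (right_sum l u)^*.
Proof.
rewrite form_cut armsM (eq_form (@armsL l u c v)) (eq_left_sum (@armsL l u c v)).
rewrite form_mirror left_sum_mirror.
rewrite (@eq_form r _ v); last by move=> k _; rewrite armsR.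
by rewrite (@eq_right_sum r _ v) //; move=> k _; rewrite armsR.
Qed.

Lemma sqnorm_arms l r u c v :
  sqnorm (l + r.+1) (arms l u c v) = sqnorm l u + sqn c + sqnorm r v.
Proof.
rewrite sqnorm_cut armsM (eq_sqnorm (@armsL l u c v)) sqnorm_mirror.
by rewrite (@eq_sqnorm r _ v) //; move=> k _; rewrite armsR.
Qed.

End Form.

(** * Extremal vectors *)

Section Support.
Context {R : rcfType} (a lam : R).
Implicit Types (x y u v : nat -> R[i]) (c z w : R[i]) (n l r k : nat).

(** The form S of the idea above; its Hermitian matrix is lam I - Re (w J). *)
Definition defect w n x : R := lam * sqnorm n x - Re (w * kms_form a n x).

Lemma eq_defect w n x y : (forall k, (k < n)%N -> x k = y k) ->
  defect w n x = defect w n y.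
Proof. by move=> e; rewrite /defect (eq_sqnorm e) (eq_form _ e). Qed.

Lemma defectD w n x y : exists c : R, forall t : R,
  defect w n (fun k => x k + t%:C * y k)
    = defect w n x + t * c + t ^+ 2 * defect w n y.
Proof.
have [c hc] := formD a n x y; have [d hd] := sqnormD n x y.
exists (lam * d - Re (w * c)) => t.
by rewrite /defect hc hd !cE /=; ring.
Qed.

Lemma defectZ w n x c :
  defect w n (fun k => c * x k) = sqn c * defect w n x.
Proof. by rewrite /defect formZ sqnormZ !cE /=; ring. Qed.

(** Along the line x + t y the form is t c + t^2 S(y); nonnegativity for every real t forces c =
    0. *)
Lemma defect_shift w n x y : (forall f, 0 <= defect w n f) ->
  defect w n x = 0 -> defect w n (fun k => x k + y k) = defect w n y.
Proof.
move=> pos x0; have [c hc] := defectD w n x y.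
suff c0 : c = 0.
  have := hc 1; rewrite x0 c0 mulr0 !add0r expr1n mul1r => <-.
  by apply: eq_defect => k _; rewrite mul1r.
set s := defect w n y in hc; have s0 : 0 <= s by apply: pos.
have key t : 0 <= t * c + t ^+ 2 * s.
  by have := pos (fun k => x k + t%:C * y k); rewrite hc x0 add0r.
(* The denominator [s + 1] is positive even when s = 0; the value obtained is minus a square. *)
have := key (- c / (s + 1)).
have s1 : s + 1 != 0 by rewrite gt_eqF // ltr_wpDl.
have -> : - c / (s + 1) * c + (- c / (s + 1)) ^+ 2 * s
          = - (c / (s + 1)) ^+ 2 by field.
rewrite oppr_ge0 => h; have /eqP : (c / (s + 1)) ^+ 2 = 0.
  by apply: le_anti; rewrite h sqr_ge0.
by rewrite sqrf_eq0 mulf_eq0 invr_eq0 (negPf s1) orbF => /eqP.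
Qed.

Lemma defect_mirror w n x : defect w n (mirror n x) = defect w^* n x.
Proof. by rewrite /defect sqnorm_mirror form_mirror !cE; ring. Qed.

Lemma defect_arms w l r u c v : defect w (l + r.+1) (arms l u c v) =
  lam * (sqnorm l u + sqn c + sqnorm r v)
  - Re (w * ((kms_form a l u)^* + kms_form a r v + c * (right_sum a l u)^*
             + right_sum a r v * c^* + right_sum a r v * (right_sum a l u)^*)).
Proof. by rewrite /defect form_arms sqnorm_arms. Qed.

Lemma zeroI (r1 r2 : R) : (forall z : R[i], Re z * r1 + Im z * r2 = 0) ->
  r1 = 0 /\ r2 = 0.
Proof.
move=> h; have := h 1; have := h (Complex 0 1); rewrite /=; lra.
Qed.

(** A zero of a nonnegative form lies in the kernel of its Hermitian matrix; this is twice row l. It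
    follows by varying the middle entry by [z]: S changes by exactly lam |z|^2, so the part linear
    in [z] vanishes. *)
Lemma defect_row w l r u c v : (forall f, 0 <= defect w (l + r.+1) f) ->
  defect w (l + r.+1) (arms l u c v) = 0 ->
  (2 * lam)%:C * c = w^* * right_sum a l u + w * right_sum a r v.
Proof.
move=> pos h.
pose d z := arms l (fun=> 0) z (fun=> 0) : nat -> R[i].
have dE z : defect w (l + r.+1) (arms l u (c + z) v)
            = defect w (l + r.+1) (arms l u c v) + lam * sqn z.
  transitivity (defect w (l + r.+1) (fun k => arms l u c v k + d z k)).
    apply: eq_defect => k _; rewrite /d /arms.
    by case: ifP => // _; rewrite ?addr0 //; case: ifP; rewrite ?addr0.
  rewrite defect_shift // /d h defect_arms !const0E !cE /=; ring.
have {}dE z : Re z * (2 * lam * Re c - Re (w^* * right_sum a l u + w * right_sum a r v))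
   + Im z * (2 * lam * Im c - Im (w^* * right_sum a l u + w * right_sum a r v)) = 0.
  have := dE z; rewrite !defect_arms /sqn !cE /= => e; lra.
have [eR eI] := zeroI dE.
by apply: complexP; move: eR eI; rewrite !cE /=; lra.
Qed.

Lemma defect_entry w n l x : (forall f, 0 <= defect w n f) ->
  defect w n x = 0 -> (l < n)%N ->
  (2 * lam)%:C * x l = w^* * left_sum a l x
    + w * right_sum a (n - l.+1) (fun k => x (l + k.+1)%N).
Proof.
move=> pos h ln; have e : n = (l + (n - l.+1).+1)%N by lia.
rewrite -right_sum_mirror; apply: defect_row; rewrite -e // -[RHS]h.
by apply: eq_defect => k kn; rewrite [RHS](@arms_split _ l (n - l.+1)) // -e.
Qed.

Context (a_gt0 : 0 < a) (a_neq1 : a != 1).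

(** The left side is the form of the matrix with entries a^|i-j|. The recurrence [left_sumS] writes
    it as a combination of squares, which shows it positive definite for a < 1. *)
Lemma sqnorm_form_sum n x : sqnorm n x + 2 * Re (kms_form a n x) =
  sqn (left_sum a n x) + (1 - a ^+ 2) * \sum_(k < n) sqn (left_sum a k x + x k).
Proof.
elim: n => [|n IH].
  by rewrite sqnorm0 form0 left_sum0 sqn0 big_ord0 /=; ring.
rewrite sqnormS formS big_ord_recr /= mulrDr left_sumS.
transitivity (sqnorm n x + 2 * Re (kms_form a n x)
  + (sqn (x n) + 2 * Re (x n * (left_sum a n x)^*))).
  by rewrite !cE; ring.
by rewrite IH /sqn !cE /=; ring.
Qed.

Lemma sqnorm_form_gt0 n x : a < 1 ->
  0 < sqnorm n x + 2 * Re (kms_form a n x) \/ (forall k, (k < n)%N -> x k = 0).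
Proof.
move=> a1; rewrite sqnorm_form_sum.
have b0 : 0 < 1 - a ^+ 2.
  rewrite (_ : _ - _ = (1 - a) * (1 + a)); last by ring.
  by apply: mulr_gt0; rewrite ?subr_gt0 ?addr_gt0.
set T := \sum_(k < n) _; have T0 : 0 <= T by apply: sumr_ge0 => i _; apply: sqn_ge0.
have [T1|nT] := eqVneq T 0; last first.
  by left; rewrite ltr_wpDl ?sqn_ge0 // mulr_gt0 // lt_neqAle eq_sym nT.
right.
have px k : (k < n)%N -> left_sum a k x + x k = 0.
  move=> kn; apply: sqn_eq0.
  by have /psumr_eq0P/(_ (Ordinal kn)) := T1; apply=> // i _; apply: sqn_ge0.
(* The left sum at k + 1 is [a] times the vanishing bracket at k, so the bracket at k + 1 reduces to
   the entry itself. *)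
move=> k kn; have := px k kn; case: k kn => [|k] kn.
  by rewrite left_sum0 add0r.
by rewrite left_sumS px ?mulr0 ?add0r // ltnW.
Qed.

(** The test vector is (1, w^*, 0, ..., 0): its squared norm is 2, and w times its form is a. *)
Lemma support_ge w n : sqn w = 1 -> (forall f, 0 <= defect w n.+2 f) ->
  a <= 2 * lam.
Proof.
move=> w1 pos.
pose x k : R[i] := if k is k'.+1 then if k' is _.+1 then 0 else w^* else 1.
have hm : sqnorm n.+2 x = 2.
  elim: n {pos} => [|m IH]; last by rewrite sqnormS IH sqn0 addr0.
  by rewrite !sqnormS sqnorm0 /sqn !cE /= sqrrN -/(sqn w) w1; ring.
have hf : kms_form a n.+2 x = a%:C * w^*.
  elim: n {pos hm} => [|m IH]; last by rewrite formS IH mul0r addr0.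
  by rewrite !formS form0 !left_sumS left_sum0; apply: complexP; rewrite !cE /=; ring.
have := pos x; rewrite /defect hm hf !cE /= => h.
have e : Re w * Re w + Im w * Im w = 1 by rewrite -w1 /sqn !expr2.
suff : Re w * (a * Re w - 0 * - Im w) - Im w * (a * - Im w + 0 * Re w) = a by lra.
by rewrite -[RHS]mulr1 -e; ring.
Qed.

(** Backward induction from the last entry. If the entries from i + 1 on vanish, rows i + 1 and i
    give w^* = - 2 lam unless x_i = 0. Then 2 lam = 1, w = -1 and a < 1, and S is half of a positive
    definite form. *)
Lemma extremal_trail w n x : sqn w = 1 -> (forall f, 0 <= defect w n.+1 f) ->
  defect w n.+1 x = 0 -> x n = 0 -> forall k, (k < n.+1)%N -> x k = 0.
Proof.
move=> w1 pos h xn.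
suff vanish m : (m <= n)%N -> forall k, (n - m <= k < n.+1)%N -> x k = 0.
  by move=> k kn; apply: (vanish n) => //; rewrite subnn.
elim: m => [|m IH] mn k kmn; first by have -> : k = n by lia.
have {}IH := IH (ltnW mn).
have [km|km] := leqP (n - m) k; first by apply: IH; lia.
pose i := (n - m.+1)%N; have -> : k = i by rewrite /i; lia.
have wn0 : w != 0.
  by apply: contra_eq_neq w1 => ->; rewrite sqn0 eq_sym oner_eq0.
have an0 : a%:C != 0 :> R[i] by rewrite fmorph_eq0 gt_eqF.
have pi : left_sum a i x = - x i.
  have := @defect_entry w n.+1 i.+1 x pos h; rewrite IH; last by rewrite /i; lia.
  rewrite mulr0 (@right_sum_zero _ a) ?mulr0 ?addr0; last first.
    by move=> j hj; apply: IH; rewrite /i in hj *; lia.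
  move=> /(_ _)/esym/eqP; rewrite !mulf_eq0 conjC_eq0 (negPf wn0) /=.
  rewrite left_sumS mulf_eq0 (negPf an0) /= addr_eq0 => e; apply/eqP/e.
  by rewrite /i; lia.
have := @defect_entry w n.+1 i x pos h.
rewrite (@right_sum_zero _ a) ?mulr0 ?addr0; last first.
  by move=> j hj; apply: IH; rewrite /i in hj *; lia.
rewrite pi => /(_ _)e; have {}e : (2 * lam)%:C * x i = w^* * - x i.
  by apply: e; rewrite /i; lia.
have [//|xi] := eqVneq (x i) 0.
have {}e : w^* = (- (2 * lam))%:C.
  by apply: (mulIf xi); rewrite rmorphN mulNr [X in - X]e mulrN [RHS]opprK.
have [wr wi] : Re w = - (2 * lam) /\ Im w = 0.
  by split; [rewrite -ReJ e | apply/eqP; rewrite -oppr_eq0 -ImJ e].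
(* [mn] makes [n] positive, which provides the two coordinates of the test vector of
   [support_ge]. *)
have hl : a <= 2 * lam.
  by case: (n) mn pos => // n' _; apply: support_ge.
have l1 : 2 * lam = 1.
  have : (2 * lam) ^+ 2 = 1 by rewrite -[RHS]w1 /sqn wr wi sqrrN expr0n /= addr0.
  move/eqP; rewrite sqrf_eq1 => /orP[/eqP//|/eqP]; move: a_gt0 hl; lra.
have a1 : a < 1 by rewrite lt_neqAle a_neq1 -l1.
have [] := sqnorm_form_gt0 n.+1 x a1; last by apply; rewrite /i; lia.
have l2 : lam = 2^-1 by lra.
by move: h; rewrite /defect !cE wr wi l2 => {}h h'; exfalso; lra.
Qed.

(** The mirror image of [extremal_trail], with [w] replaced by its conjugate. *)
Lemma extremal_lead w n x : sqn w = 1 -> (forall f, 0 <= defect w n.+1 f) ->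
  defect w n.+1 x = 0 -> x 0%N = 0 -> forall k, (k < n.+1)%N -> x k = 0.
Proof.
move=> w1 pos h x0 k kn; rewrite -(mirrorK x kn).
apply: (@extremal_trail w^* n (mirror n.+1 x)).
- by rewrite /sqn !cE sqrrN.
- by move=> f; rewrite -defect_mirror.
- by rewrite defect_mirror conjCK.
- by rewrite /mirror subnn.
- by lia.
Qed.


Definition truncate l u : nat -> R[i] := fun k => if (k < l)%N then u k else 0.

Lemma truncate_sums l d u (f := truncate l u) :
  [/\ kms_form a (l + d) f = kms_form a l u, sqnorm (l + d) f = sqnorm l u
    & right_sum a (l + d) f = right_sum a l u].
Proof.
have e k : (k < l)%N -> f k = u k by rewrite /f /truncate => ->.
elim: d => [|d [IHf IHm IHs]].
  by rewrite addn0; split; [apply: eq_form | apply: eq_sqnorm | apply: eq_right_sum].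
have f0 : f (l + d)%N = 0 by rewrite /f /truncate ltnNge leq_addr.
by rewrite addnS formS sqnormS right_sumS f0 IHf IHm IHs sqn0 mul0r mulr0 !addr0.
Qed.

(** Here [l] and [r] are the lengths of the arms on either side of the zero entry. The conclusions
    come from evaluating S on vectors assembled from the two arms. *)
Lemma extremal_zero w l r x : sqn w = 1 -> (0 < l + r)%N ->
  (forall f, 0 <= defect w (l + r.+1) f) -> defect w (l + r.+1) x = 0 ->
  x l = 0 -> (exists2 k, (k < l + r.+1)%N & x k != 0) ->
  [/\ w = -1, l = r, 1 < a &
      forall k, (k < l)%N -> x (l + k.+1)%N = - x (l - k.+1)%N].
Proof.
move=> w1 lr pos x0 xl [k0 k0n xk0].
have trail f : defect w (l + r.+1) f = 0 -> f (l + r)%N = 0 ->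
    forall k, (k < l + r.+1)%N -> f k = 0.
  by move: pos; rewrite addnS => pos; apply: extremal_trail.
have lead f : defect w (l + r.+1) f = 0 -> f 0%N = 0 ->
    forall k, (k < l + r.+1)%N -> f k = 0.
  by move: pos; rewrite addnS => pos; apply: extremal_lead.
set u := mirror l x; pose v k := x (l + k.+1)%N.
have xE k : (k < l + r.+1)%N -> x k = arms l u 0 v k.
  by move=> kn; rewrite (@arms_split _ l r) // xl.
have D0 : defect w (l + r.+1) (arms l u 0 v) = 0.
  by rewrite -[RHS]x0; apply: eq_defect => k kn; rewrite xE.
have w_unit : Re w * Re w + Im w * Im w = 1 by rewrite -w1 /sqn !expr2.
have ww : w * w^* = 1 by apply: complexP; rewrite !cE /=; lra.
pose s := right_sum a l u; pose t := right_sum a r v.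
have st : t = - (w^* * (w^* * s)).
  have := defect_row pos D0; rewrite mulr0 -/s -/t => e.
  have : w^* * (w^* * s + w * t) = 0 by rewrite -e mulr0.
  rewrite mulrDr [w^* * (w * t)]mulrA [w^* * w]mulrC ww mul1r => {}e.
  by apply/eqP; rewrite -addr_eq0 addrC e.
(* If s = t = 0 the arms decouple: each one alone, padded with zeros, is a zero of S with a zero end
   entry, hence vanishes. *)
have s_neq0 : s != 0.
  apply: contraNneq xk0 => s0; have t0 : t = 0 by rewrite st s0 !mulr0 oppr0.
  pose U := arms l u 0 (fun=> 0) : nat -> R[i].
  pose V := arms l (fun=> 0) 0 v : nat -> R[i].
  have UV : defect w (l + r.+1) U + defect w (l + r.+1) V = 0.
    rewrite -[RHS]D0 /U /V !defect_arms -/s -/t s0 t0 !const0E sqn0 !cE /=; ring.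
  have := pos U; have := pos V => pV pU.
  have U0 : defect w (l + r.+1) U = 0 by lra.
  have V0 : defect w (l + r.+1) V = 0 by lra.
  have {}U0 := trail _ U0; have {}V0 := lead _ V0.
  have [kl|lk] := ltnP k0 l.
    have <- : U k0 = x k0 by rewrite /U armsL // xE // armsL.
    apply/eqP; apply: U0 => //; rewrite /U /arms.
    by case: ifP => [|_]; [lia | case: ifP].
  have <- : V k0 = x k0.
    by rewrite xE // /V /arms ltnNge lk.
  apply/eqP; apply: V0 => //; rewrite /V /arms.
  by case: ifP => // l0; case: ifP => // l0'; lia.
have sqs : 0 < sqn s.
  by rewrite lt_neqAle sqn_ge0 andbT; apply: contra_neq s_neq0 => /esym/sqn_eq0.
have wt : w * t = - (w^* * s).
  by rewrite st mulrN [w * _]mulrA ww mul1r.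
(* Replacing v by - w v changes only the coupling term of S; comparison with S(u, 0, v) = 0 gives Re
   w <= -1. *)
have wE : w = -1.
  have := pos (arms l u 0 (fun k => - w * v k)); have := D0.
  rewrite !defect_arms sqnormZ formZ right_sumZ sqnN w1 mul1r sqn0 -/s -/t => d0 d1.
  have e1 : Re (w * (w * t) * s^*) = - sqn s.
    by rewrite wt mulrN [w * _]mulrA ww mul1r mulNr /sqn !cE /=; ring.
  have e2 : Re (w * t * s^*) = - (Re w * sqn s).
    by rewrite wt /sqn !cE /=; ring.
  have h : Re w <= -1.
    by rewrite -(ler_pM2r sqs) mulN1r; move: d0 d1 e1 e2; rewrite !cE /=; lra.
  have rw : Re w = -1 by nra.
  by apply: complexP; rewrite // rw in w_unit *; rewrite /=; nra.
have {st wt} tE : t = - s.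
  by move: wt; rewrite wE rmorphN rmorph1 !mulN1r opprK => <-; rewrite opprK.
rewrite wE in pos D0 trail lead.
have S d1 d2 : defect (-1) (l + r.+1) (arms l d1 0 d2) = 
   (lam * sqnorm l d1 + Re (kms_form a l d1)) + (lam * sqnorm r d2 + Re (kms_form a r d2))
   + Re (right_sum a r d2 * (right_sum a l d1)^*).
  by rewrite defect_arms !cE /= sqn0; ring.
pose A := lam * sqnorm l u + Re (kms_form a l u).
pose B := lam * sqnorm r v + Re (kms_form a r v).
have AB : A + B = sqn s.
  by move: D0; rewrite S -/A -/B -/s -/t tE /sqn !cE; lra.
(* S(-u, 0, v) is computed twice: it is 4 A by translation along the zero (u, 0, v), and A + B +
   |s|^2 = 2 |s|^2 directly. *)
have A2 : 2 * A = sqn s.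
  have := @defect_shift (-1) _ _ (arms l (fun k => (-2) * u k) 0 (fun=> 0)) pos D0.
  rewrite (@eq_defect _ _ _ (arms l (fun k => (-1) * u k) 0 v)); last first.
    move=> k _; rewrite /arms; case: ifP => _; first by ring.
    by case: ifP => _; rewrite addr0.
  rewrite !S !const0E !sqnormZ !formZ !right_sumZ -/s -/t -/A -/B tE /sqn !cE /=.
  by move: AB; rewrite /A /B /sqn; lra.
have B2 : 2 * B = sqn s by lra.
have s0 f l' : (forall k, (k < l')%N -> f k = 0) -> right_sum a l' f = 0.
  exact: right_sum_zero.
(* If one arm is longer, replacing it by the other arm, negated and padded with zeros, gives a zero
   of S with a zero end entry. That vector vanishes, and s with it. *)
have lE : l = r.
  apply/eqP; rewrite eqn_leq -[_ && _]negbK negb_and -!ltnNge.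
  apply: contra_neqN s_neq0 => /orP[rl|lr'].
    have [d ld] : exists d, l = (r + d.+1)%N by exists (l - r.+1)%N; lia.
    have [tf tm ts] := truncate_sums r d.+1 (fun k => - 1 * v k).
    have z0 : defect (-1) (l + r.+1) (arms l (truncate r (fun k => - 1 * v k)) 0 v) = 0.
      rewrite S {1 2 3}ld tf tm ts sqnormZ formZ right_sumZ -/t -/B tE.
      by move: B2; rewrite /B /sqn !cE /=; lra.
    apply: (can_inj (@opprK _)); rewrite -tE oppr0; apply: s0 => k kr.
    rewrite -[LHS](armsR l (truncate r (fun k => - 1 * v k)) 0).
    apply: lead z0 _ _ _; last by rewrite ltn_add2l ltnS.
    rewrite armsL; last by lia.
    by rewrite /mirror /truncate; case: ifP => //; lia.
  have [d rd] : exists d, r = (l + d.+1)%N by exists (r - l.+1)%N; lia.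
  have [tf tm ts] := truncate_sums l d.+1 (fun k => - 1 * u k).
  have z0 : defect (-1) (l + r.+1) (arms l u 0 (truncate l (fun k => - 1 * u k))) = 0.
    rewrite S {1 2 3}rd tf tm ts sqnormZ formZ right_sumZ -/s -/A.
    by move: A2; rewrite /A /sqn !cE /=; lra.
  apply: s0 => k kl.
  have -> : u k = arms l u 0 (truncate l (fun k => - 1 * u k)) (l - k.+1)%N.
    by rewrite armsL /mirror; [congr (u _)|]; lia.
  apply: trail z0 _ _ _; last by lia.
  by rewrite {1}rd addnS armsR /truncate; case: ifP => //; lia.
subst r; split=> //.
  (* For a < 1 positive definiteness gives lam < 1/2, whereas S(u, -2s, u) = (4 lam - 2) |s|^2 must
     be nonnegative. *)
  rewrite ltNge le_eqVlt (negPf a_neq1) /=; apply/negP => a1.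
  have [Fx|Fx] := sqnorm_form_gt0 (l + l.+1) x a1; last by rewrite Fx ?eqxx in xk0.
  have := pos (arms l u (-2 * s) u); rewrite defect_arms -/s.
  have : lam < 2^-1.
    have m0 := sqnorm_ge0 (l + l.+1) x.
    move: x0; rewrite /defect wE !cE /= => x0'.
    rewrite ltNge; apply/negP => h.
    nra.
  by move: A2 sqs; rewrite /A /sqn !cE /= => h1 h2 h3 h4; nra.
have z0 : defect (-1) (l + l.+1) (arms l u 0 (fun k => -1 * u k)) = 0.
  by rewrite S sqnormZ formZ right_sumZ -/s -/A; move: A2; rewrite /A /sqn !cE /=; lra.
(* The difference of the zeros (u, 0, v) and (u, 0, -u) is a zero of S whose first entry is 0, so it
   vanishes and v = -u. *)
have z1 : defect (-1) (l + l.+1) (arms l (fun=> 0) 0 (fun k => v k + u k)) = 0.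
  have := @defect_shift (-1) _ _ (fun k => -1 * arms l u 0 (fun k => -1 * u k) k) pos D0.
  rewrite defectZ z0 mulr0 => <-; apply: eq_defect => k _; rewrite /arms.
  case: ifP => _; first by ring.
  by case: ifP => _; ring.
move=> k kl; apply/eqP; rewrite -addr_eq0 -/(u k) -/(v k).
rewrite -[X in X == _](armsR l (fun=> 0) 0 (fun k => v k + u k)) lead //; last by lia.
by rewrite /arms; case: ifP => // h; lia.
Qed.

(** Exchanging the arms preserves S when w = -1, so x minus its reversal is a zero of S with middle
    entry 0. It is nonzero unless x is symmetric, the case in which a square is completed. *)
Lemma extremal_odd l x : 1 < a -> (0 < l)%N ->
  (forall f, 0 <= defect (-1) (l + l.+1) f) -> defect (-1) (l + l.+1) x = 0 ->
  (exists2 k, (k < l + l.+1)%N & x k != 0) ->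
  exists y, [/\ defect (-1) (l + l.+1) y = 0, y l = 0
              & exists2 k, (k < l + l.+1)%N & y k != 0].
Proof.
move=> a1 l0 pos x0 [k0 k0n xk0].
set u := mirror l x; pose v k := x (l + k.+1)%N; pose c := x l.
have xE k : (k < l + l.+1)%N -> x k = arms l u c v k by exact: arms_split.
have D0 : defect (-1) (l + l.+1) (arms l u c v) = 0.
  by rewrite -[RHS]x0; apply: eq_defect => k kn; rewrite xE.
pose y k := arms l u c v k + (-1) * arms l v c u k.
have [/forallP eq_uv|/forallPn[k neq_uv]] := boolP [forall k : 'I_l, u k == v k]; last first.
  exists y; split.
  - rewrite /y defect_shift // defectZ -[RHS](mulr0 (sqn (-1))) -D0.
    by congr (_ * _); rewrite !defect_arms !cE /=; ring.
  - by rewrite /y !armsM mulN1r addrN.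
  - exists (l + k.+1)%N; first by rewrite ltn_add2l ltnS.
    by rewrite /y !armsR mulN1r subr_eq0 eq_sym.
have {}eq_uv k : (k < l)%N -> v k = u k.
  by move=> kl; have /eqP := eq_uv (Ordinal kl).
pose z := arms l u 0 (fun k => -1 * u k).
have lam_gt : 1 < 2 * lam.
  apply: lt_le_trans a1 _; apply: (@support_ge (-1) (l + l.-1)%N).
    by rewrite /sqn !cE /=; ring.
  by have <- : (l + l.+1 = (l + l.-1).+2)%N by lia.
pose s := right_sum a l u.
have Dx : 2 * (lam * sqnorm l u + Re (kms_form a l u))
    + lam * sqn c + 2 * Re (c * s^*) + sqn s = 0.
  rewrite -[RHS]D0 defect_arms (eq_sqnorm eq_uv) (eq_form _ eq_uv) (eq_right_sum _ eq_uv).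
  by rewrite -/s /sqn !cE /=; ring.
have Dz : defect (-1) (l + l.+1) z =
    2 * (lam * sqnorm l u + Re (kms_form a l u)) - sqn s.
  by rewrite /z defect_arms sqnormZ formZ right_sumZ -/s /sqn !cE /=; ring.
have := pos z; rewrite Dz => z_ge0.
(* The left side equals -2 S(z). As 2 lam > 1, both terms are nonnegative, so c = 0 and S(z) = 0. *)
have key : (2 * lam - 1) * sqn c + sqn (c + 2 * s) <= 0.
  by move: Dx z_ge0; rewrite /sqn !cE /=; lra.
have c0 : sqn c = 0.
  have := sqn_ge0 c; have := sqn_ge0 (c + 2 * s); nra.
exists z; split.
- rewrite Dz; move: Dx; rewrite c0 (sqn_eq0 c0) => e.
  have := sqn_ge0 s; move: key z_ge0 e; rewrite (sqn_eq0 c0) /sqn !cE /=; lra.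
- by rewrite /z armsM.
have [kl|lk] := ltnP k0 l.
  by exists k0 => //; rewrite /z armsL // -(@armsL _ l u c v) // -xE.
have [e|lk'] := eqVneq k0 l.
  by move: xk0; rewrite e -/c (sqn_eq0 c0) eqxx.
exists k0 => //.
have e : k0 = (l + (k0 - l.+1).+1)%N by lia.
move: xk0; rewrite xE // e /z !armsR eq_uv; last by lia.
by rewrite mulN1r oppr_eq0.
Qed.

End Support.

(** * Numerical ranges *)

Section NumericalRangeTopology.
Context {C : numClosedFieldType}.
Implicit Types (p q : C) (S : set C).

Lemma closure_normP S p :
  closure S p <-> forall e : C, 0 < e -> exists2 q, S q & `|p - q| < e.
Proof.
split=> [cl e e0|h B /nbhs_ballP[e /= e0 eB]].
  by have [q [Sq pq]] := cl _ (nbhsx_ballx p e e0); exists q.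
by have [q Sq pq] := h e e0; exists q; split=> //; apply: eB.
Qed.

Lemma interior_normP S p :
  interior S p <-> exists2 e : C, 0 < e & forall q, `|p - q| < e -> S q.
Proof.
split=> [/nbhs_ballP[e /= e0 eS]|[e e0 eS]]; first by exists e.
by apply/nbhs_ballP; exists e.
Qed.

Lemma cdotE n (x y : 'cV[C]_n) : cdot x y = \sum_i x i 0 * (y i 0)^*.
Proof. by rewrite /cdot dotmxE !mxE; apply: eq_bigr => i _; rewrite !mxE. Qed.

Lemma cdot_sqE n (x : 'cV[C]_n) : cdot x x = \sum_i `|x i 0| ^+ 2.
Proof. by rewrite cdotE; apply: eq_bigr => i _; rewrite normCK. Qed.

Lemma cnorm1P n (x : 'cV[C]_n) : cnorm x = 1 <-> cdot x x = 1.
Proof.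
rewrite /cnorm; split=> [h|->]; last by rewrite sqrtC1.
by rewrite -[LHS]sqrtCK h expr1n.
Qed.

Lemma continuous_conjC : continuous (fun z : C => z^*).
Proof.
move=> z B /nbhs_ballP[e /= e0 eB]; apply/nbhs_ballP; exists e => // y zy.
by apply: eB; rewrite /ball /= -rmorphB norm_conjC.
Qed.

Lemma continuous_sum (T : topologicalType) (I : finType) (F : I -> T -> C) :
  (forall i, continuous (F i)) -> continuous (fun x => \sum_i F i x).
Proof.
move=> cF x; apply: cvg_big => [|i _]; last exact: cF.
exact: add_continuous.
Qed.

Lemma continuous_mul (T : topologicalType) (f g : T -> C) :
  continuous f -> continuous g -> continuous (fun x => f x * g x).
Proof. by move=> cf cg x; apply: cvgM; [exact: cf | exact: cg]. Qed.

(** A continuous image of the unit sphere, which is closed in a product of discs. Compactness of the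
    disc depends on [C] (it fails for the algebraic numbers), so it is a hypothesis;
    [complex_disc_compact] supplies it for [R[i]]. *)
Lemma numerical_range_closed n (A : 'M[C]_n) :
  compact [set z : C | `|z| <= 1] -> closed (numerical_range A).
Proof.
move=> disc; apply: compact_closed; first exact: norm_hausdorff.
pose f (v : 'rV[C]_n) := \sum_i (\sum_k A i k * v 0 k) * (v 0 i)^*.
pose K := [set v : 'rV[C]_n | \sum_i v 0 i * (v 0 i)^* = 1].
have ccoord i : continuous (fun v : 'rV[C]_n => (v 0 i)^*).
  move=> v; apply: (@cvg_comp _ _ _ (fun v : 'rV[C]_n => v 0 i)).
    exact: coord_continuous.
  exact: continuous_conjC.
have -> : numerical_range A = [set f v | v in K].
  apply/seteqP; split=> [_ [x /= x1 <-]|_ [v /= v1 <-]].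
    exists x^T => /=.
      by move/cnorm1P: x1; rewrite cdotE /K /= => <-; apply: eq_bigr => i _; rewrite !mxE.
    rewrite cdotE /f; apply: eq_bigr => i _; rewrite !mxE.
    by congr (_ * _); apply: eq_bigr => k _; rewrite !mxE.
  exists v^T => /=.
    by apply/cnorm1P; rewrite cdotE -v1; apply: eq_bigr => i _; rewrite !mxE.
  rewrite cdotE /f; apply: eq_bigr => i _; rewrite !mxE.
  by congr (_ * _); apply: eq_bigr => k _; rewrite !mxE.
have crow i : continuous (fun v : 'rV[C]_n => \sum_k A i k * v 0 k).
  apply: continuous_sum => k; apply: continuous_mul; last exact: coord_continuous.
  exact: cst_continuous.
apply: continuous_compact.
  apply: continuous_subspaceT; apply: continuous_sum => i.
  exact: continuous_mul.
have cK : closed K.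
  have cg : continuous (fun v : 'rV[C]_n => \sum_i v 0 i * (v 0 i)^* : C).
    apply: continuous_sum => i.
    by apply: continuous_mul => //; exact: coord_continuous.
  have /continuous_closedP cg' := cg.
  apply: (cg' [set 1]); exact/accessible_closed_set1/hausdorff_accessible/norm_hausdorff.
apply: subclosed_compact cK (rV_compact (fun=> disc)) _ => v /= v1 i.
have : `|v 0 i| ^+ 2 <= 1.
  rewrite -v1 (bigD1 i) //= -normCK lerDl sumr_ge0 // => k _.
  by rewrite -normCK exprn_ge0.
by rewrite expr_le1.
Qed.


Lemma cdot_mxE n (x y : 'cV[C]_n) : cdot x y = (y^t* *m x) 0 0.
Proof. by rewrite cdotE mxE; apply: eq_bigr => i _; rewrite !mxE mulrC. Qed.

Lemma cdot_adj n (A : 'M[C]_n) (x y : 'cV[C]_n) :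
  cdot (A *m x) y = cdot x (A^t* *m y).
Proof. by rewrite !cdot_mxE trmx_mul map_mxM mulmxA trmxCK. Qed.

Lemma cdotC n (x y : 'cV[C]_n) : cdot y x = (cdot x y)^*.
Proof.
rewrite !cdotE rmorph_sum; apply: eq_bigr => i _.
by rewrite rmorphM /= conjCK mulrC.
Qed.

Lemma cdotDl n (x y z : 'cV[C]_n) : cdot (x + y) z = cdot x z + cdot y z.
Proof. by rewrite !cdot_mxE mulmxDr mxE. Qed.
Lemma cdotZl n c (x z : 'cV[C]_n) : cdot (c *: x) z = c * cdot x z.
Proof. by rewrite !cdot_mxE -scalemxAr mxE. Qed.
Lemma cdotDr n (x y z : 'cV[C]_n) : cdot z (x + y) = cdot z x + cdot z y.
Proof. by rewrite cdotC cdotDl rmorphD /= -!cdotC. Qed.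
Lemma cdotZr n c (x z : 'cV[C]_n) : cdot z (c *: x) = c^* * cdot z x.
Proof. by rewrite cdotC cdotZl rmorphM /= -cdotC. Qed.

Lemma cdot_ge0 n (x : 'cV[C]_n) : 0 <= cdot x x.
Proof. by rewrite cdot_sqE sumr_ge0 // => i _; rewrite exprn_ge0. Qed.

Lemma cdot_eq0 n (x : 'cV[C]_n) : cdot x x = 0 -> x = 0.
Proof.
rewrite cdot_sqE => /psumr_eq0P h; apply/colP => i; rewrite mxE.
have /eqP := h (fun i _ => exprn_ge0 2 (normr_ge0 (x i 0))) i isT.
by rewrite expf_eq0 /= normr_eq0 => /eqP.
Qed.

Lemma re_mxE n (A : 'M[C]_n) (x : 'cV[C]_n) :
  cdot (re_mx A *m x) x = 'Re (cdot (A *m x) x).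
Proof.
rewrite /re_mx -scalemxAl mulmxDl cdotZl cdotDl [cdot (A^t* *m x) x]cdotC.
by rewrite -cdot_adj ReE mulrC.
Qed.

(** In spectral coordinates y the form is the sum of d_i |y_i|^2 with every d_i >= b, so equality
    forces y_i = 0 wherever d_i differs from b. *)
Lemma re_mx_min n (A : 'M[C]_n) b : is_min (spectrum (re_mx A)) b ->
  [/\ b \is Num.real,
      forall x : 'cV_n, b * cdot x x <= 'Re (cdot (A *m x) x),
      forall x : 'cV_n, 'Re (cdot (A *m x) x) = b * cdot x x -> re_mx A *m x = b *: x
    & exists2 x : 'cV_n, x != 0 & re_mx A *m x = b *: x].
Proof.
move=> [bH bmin]; set H := re_mx A in bH bmin *.
have Hherm : H^t* = H.
  rewrite /H /re_mx linearZ /= map_mxZ linearD /= map_mxD trmxCK addrC.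
  by congr (_ *: _); rewrite fmorphV rmorphMn rmorph1.
have Hh : H \is hermsymmx.
  by apply/is_hermitianmxP; rewrite expr0 scale1r Hherm.
have /orthomx_spectralP HE := hermitian_normalmx Hh.
have dR := hermitian_spectral_diag_real Hh.
set P := spectralmx H in HE; set d := spectral_diag H in HE dR.
have PU : P \is unitarymx by apply: spectral_unitarymx.
have Pu : P \in unitmx by apply: unitarymx_unit.
have PH : P *m H = diag_mx d *m P.
  by rewrite {1}HE -!mulmxA mulKVmx.
have dle i : b <= d 0 i.
  apply: bmin; apply/eigenvalueP; exists (row i P).
    by rewrite -row_mul PH row_mul row_diag_mx -scalemxAl -rowE.
  apply: contraTneq isT => r0; have : delta_mx 0 i *m P *m invmx P = 0 :> 'rV[C]_n.
    by rewrite -rowE r0 mul0mx.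
  rewrite mulmxK // => /rowP/(_ i)/eqP; rewrite !mxE !eqxx /=.
  by rewrite oner_eq0.
have dreal i : d 0 i \is Num.real by move/mxOverP: dR.
have /eigenvalueP[v vH v0] := bH.
(* The nonzero eigenvector provides an index; comparability of [b] with the real number [d 0 i0]
   then makes [b] real. *)
have [i0 _] : exists i, v 0 i != 0.
  by apply/existsP; apply: contraNT v0 => /existsPn h; apply/eqP/rowP => i;
    rewrite mxE; apply/eqP; rewrite -[_ == _]negbK h.
have breal : b \is Num.real by rewrite (ler_real (dle i0)).
have PP : P^t* *m P = 1%:M by rewrite -invmx_unitary // mulVmx.
have normP x : cdot x x = \sum_i `|(P *m x) i 0| ^+ 2.
  by rewrite -cdot_sqE cdot_adj mulmxA PP mul1mx.
have formP x : 'Re (cdot (A *m x) x) = \sum_i d 0 i * `|(P *m x) i 0| ^+ 2.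
  rewrite -re_mxE -/H HE invmx_unitary // -!mulmxA cdot_adj trmxCK cdotE.
  apply: eq_bigr => i _; rewrite mul_diag_mx mxE -mulrA normCK.
  by [].
split=> //.
- move=> x; rewrite normP formP mulr_sumr; apply: ler_sum => i _.
  by apply: ler_wpM2r; rewrite ?exprn_ge0.
- move=> x; rewrite normP formP mulr_sumr => e.
  have {}e : \sum_i (d 0 i - b) * `|(P *m x) i 0| ^+ 2 = 0.
    by under eq_bigr do rewrite mulrBl; rewrite sumrB e subrr.
  have e0 i : (d 0 i - b) * `|(P *m x) i 0| ^+ 2 = 0.
    have /psumr_eq0P h := e; apply: h => // k _.
    by apply: mulr_ge0; rewrite ?subr_ge0 ?exprn_ge0.
  have Dy : diag_mx d *m (P *m x) = b *: (P *m x).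
    apply/colP => i; rewrite mul_diag_mx !mxE.
    have /eqP := e0 i; rewrite mulf_eq0 subr_eq0 expf_eq0 normr_eq0 /=.
    by rewrite mxE => /orP[/eqP->//|/eqP->]; rewrite !mulr0.
  by rewrite HE invmx_unitary // -!mulmxA Dy -scalemxAr mulmxA PP mul1mx.
(* [eigenvalue] is about row vectors; as H is Hermitian and b real, the conjugate transpose is a
   column eigenvector. *)
exists (v^t*).
  apply: contraNneq v0 => h; rewrite -[v]trmxCK h.
  by rewrite trmx0 map_mx0.
rewrite -[H in H *m _]Hherm -map_mxM -trmx_mul vH linearZ /= map_mxZ.
by rewrite /= conj_Creal.
Qed.

End NumericalRangeTopology.

(** * Boundary points and compactness in the complex plane *)

Section ComplexTopology.
Context {R : realType}.
Implicit Types (z p q : R[i]) (e r t : R).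

Lemma normc_lt z e : 0 < e -> (`|z| < e%:C) = (sqn z < e ^+ 2).
Proof.
move=> e0; rewrite normc_def ltcR -/(sqn z) -[in LHS](gtr0_norm e0) -sqrtr_sqr.
by rewrite ltr_sqrt // exprn_gt0.
Qed.

Lemma complex_gt0 (c : R[i]) : 0 < c -> exists2 e, 0 < e & c = e%:C.
Proof. by case: c => x y; rewrite ltcE /= => /andP[/eqP -> x0]; exists x. Qed.

Lemma boundaryP (S : set R[i]) p : boundary S p <->
  (forall e, 0 < e -> exists2 q, S q & sqn (p - q) < e ^+ 2) /\
  (forall e, 0 < e -> exists2 q, ~ S q & sqn (p - q) < e ^+ 2).
Proof.
rewrite /boundary /setD /=; split=> [[/closure_normP cl /interior_normP int]|[cl int]].
  split=> e e0.
    by have [|q Sq] := cl e%:C; [rewrite ltcR | rewrite normc_lt //; exists q].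
  apply: contrapT => h; apply: int; exists e%:C; first by rewrite ltcR.
  move=> q; rewrite normc_lt // => pq; apply: contrapT => Sq; apply: h.
  by exists q.
split; first apply/closure_normP => c /complex_gt0[e e0 ->].
  by have [q Sq pq] := cl e e0; exists q => //; rewrite normc_lt.
move/interior_normP => [c /complex_gt0[e e0 ->] h].
by have [q Sq pq] := int e e0; apply: Sq; apply: h; rewrite normc_lt.
Qed.

(** The disc is a closed subset of the image of the compact square [-1, 1] x [-1, 1]. *)
Lemma complex_disc_compact (C := R[i] : numClosedFieldType) :
  compact [set z : C | `|z| <= 1].
Proof.
pose f (u : R * R) : C := Complex u.1 u.2.
have cf : continuous f.
  move=> u B /nbhs_ballP[c /= /complex_gt0[e e0 ->] eB].
  have e2 : 0 < e / 2 by rewrite divr_gt0.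
  apply: filterS (nbhsx_ballx u (e / 2) e2) => v [/= h1 h2]; apply: eB.
  rewrite /ball /= in h1 h2 *; rewrite (normc_lt _ e0) /sqn /f /=.
  move: h1 h2; rewrite !ltr_norml => /andP[h1 h2] /andP[h3 h4]; nra.
have K := compact_setX (segment_compact (a := -1 : R) (b := 1)) (segment_compact (a := -1 : R) (b := 1)).
have {}K := continuous_compact (continuous_subspaceT cf) K.
apply: subclosed_compact K _.
  move=> p /closure_normP cl /=; rewrite -[_ <= _]negbK -real_ltNge ?normr_real //.
  apply/negP => p1; have [|q q1 pq] := cl (`|p| - 1); first by rewrite subr_gt0.
  have : `|p| < `|p|; last by rewrite ltxx.
  rewrite -{1}[p](subrK q); apply: le_lt_trans (ler_normD _ _) _.
  by rewrite -[X in _ < X](subrK 1); apply: ltr_leD.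
move=> z /= z1; exists (Re z, Im z); last by rewrite /f; case: (z).
have {z1} : sqn z <= 1.
  rewrite -lecR [X in X <= _]add_Re2_Im2.
  by rewrite expr_le1.
rewrite /sqn /= !in_itv /= => z1; split; apply/andP; split; nra.
Qed.

End ComplexTopology.

Definition convexC (R : rcfType) (K : set R[i]) := forall (p q : R[i]) (t : R),
  K p -> K q -> 0 <= t <= 1 -> K ((1 - t)%:C * p + t%:C * q).

(** * Supporting lines and convexity of the numerical range *)

Section SupportingLine.
Context {R : realType}.
Implicit Types (z p q w : R[i]) (e r t : R) (K : set R[i]).

(* The slope of a separating line is an infimum of slopes. *)
Lemma half_separation K p q : convexC K -> K p -> 0 < Im p -> K q -> Im q < 0 ->
  (exists2 r, r < 0 & K r%:C) \/
  (exists s : R, forall z, K z -> s * Im z <= Re z).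
Proof.
move=> cK Kp p0 Kq q0.
have [|neg] := pselect (exists2 r, r < 0 & K r%:C); [by left|right].
have cross z y : K z -> 0 < Im z -> K y -> Im y < 0 ->
    Re y / Im y <= Re z / Im z.
  move=> Kz z0 Ky y0; rewrite leNgt; apply/negP => lt.
  have d0 : 0 < Im z - Im y by lra.
  (* At this parameter the segment from [z] to [y] meets the real axis; slopes in the wrong order
     would put that point on the negative half-axis. *)
  pose t := Im z / (Im z - Im y).
  have tb : 0 <= t <= 1.
    by rewrite /t divr_ge0 ?(ltW z0) ?(ltW d0) //= ler_pdivrMr //; lra.
  apply: neg; exists ((Re y * Im z - Re z * Im y) / (Im z - Im y)).
    rewrite pmulr_llt0 ?invr_gt0 //.
    move: lt; rewrite ltr_pdivrMr // mulrAC ltr_ndivlMr //; lra.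
  have := cK z y t Kz Ky tb; congr K; apply: complexP; rewrite !cE /= /t; field; lra.
pose X := [set Re z / Im z | z in [set z | K z /\ 0 < Im z]].
have Xlb : lbound X (Re q / Im q) by move=> _ [z [Kz z0] <-]; apply: cross.
have Xinf : has_inf X.
  by split; [exists (Re p / Im p); exists p | exists (Re q / Im q)].
exists (inf X) => z Kz; have [z0|z0|z0] := ltgtP (Im z) 0.
- rewrite -ler_ndivrMr //; apply: lb_le_inf; first by case: Xinf.
  by move=> _ [y [Ky y0] <-]; apply: cross.
- rewrite -ler_pdivlMr //; apply: ge_inf; first by case: Xinf.
  by exists z.
- rewrite z0 mulr0 leNgt; apply/negP => rz; apply: neg; exists (Re z) => //.
  by congr K : (Kz); apply: complexP.
Qed.

(** The triangle with vertices r1, r2 and k contains a half-disc centred at 0: there z = (1 - t) x +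
    t k with t = Im z / Im k and x real between r2 and r1. *)
Lemma wedge_interior K k r1 r2 : convexC K -> K k -> Im k != 0 ->
  K r1%:C -> 0 < r1 -> K r2%:C -> r2 < 0 ->
  exists2 e, 0 < e & forall z, sqn z < e ^+ 2 -> 0 <= Im z * Im k -> K z.
Proof.
move=> cK Kk k0 K1 r10 K2 r20.
have seg x : r2 <= x <= r1 -> K x%:C.
  move=> /andP[h1 h2]; pose t := (x - r2) / (r1 - r2).
  have d0 : 0 < r1 - r2 by lra.
  have tb : 0 <= t <= 1.
    by rewrite /t divr_ge0 ?subr_ge0 //= ?ler_pdivrMr ?(ltW d0) //; lra.
  have := cK _ _ t K2 K1 tb; congr K; apply: complexP; rewrite !cE /= /t; field; lra.
pose m := Num.min 1 (Num.min r1 (- r2)).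
have m0 : 0 < m by rewrite !lt_min ltr01 r10 oppr_gt0.
have [m1 m2 m3] : [/\ m <= 1, m <= r1 & m <= - r2].
  by rewrite /m !ge_min !lexx ?orbT.
pose D := 2 * (1 + `|Re k| + `|Im k|).
have Ik : 0 < `|Im k| by rewrite normr_gt0.
have Rk : 0 <= `|Re k| by [].
have D0 : 0 < D by rewrite /D; lra.
(* This radius yields t <= 1/2 and |Re z - t Re k| <= m / 2, so after division by 1 - t the real
   point stays in [-m, m], within [r2, r1]. *)
exists (`|Im k| * m / D); first by rewrite divr_gt0 ?mulr_gt0.
set e := _ / D => z ze zk.
have e0 : 0 < e by rewrite divr_gt0 ?mulr_gt0.
have eD : e * D = `|Im k| * m by rewrite mulfVK // gt_eqF.
have sq_lt (x y : R) : x ^+ 2 + y ^+ 2 < e ^+ 2 -> `|x| < e.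
  move=> h; rewrite -(gtr0_norm e0) -ltr_sqr ?nnegrE ?normr_ge0 //.
  by rewrite !real_normK ?num_real //; have := sqr_ge0 y; lra.
have Rz : `|Re z| < e by apply: (@sq_lt _ (Im z)).
have Iz : `|Im z| < e by apply: (@sq_lt _ (Re z)); rewrite addrC.
pose t := Im z / Im k.
have t0 : 0 <= t.
  have -> : t = Im z * Im k / Im k ^+ 2 by rewrite /t; field.
  by rewrite divr_ge0 ?sqr_ge0.
have tE : t * `|Im k| = `|Im z|.
  by rewrite -(ger0_norm t0) -normrM /t mulfVK.
have t12 : t <= 2^-1.
  rewrite -(ler_pM2r Ik) tE; apply: le_trans (ltW Iz) _.
  rewrite -(ler_pM2r D0) eD /D; nra.
have bnd : `|Re z - t * Re k| <= m / 2.
  apply: le_trans (ler_normB _ _) _; rewrite normrM (ger0_norm t0).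
  rewrite -(ler_pM2r Ik) mulrDl mulrAC tE.
  have : e * (`|Im k| + `|Re k|) <= m / 2 * `|Im k|.
    by move: eD; rewrite /D; nra.
  by nra.
have K3 : K ((Re z - t * Re k) / (1 - t))%:C.
  apply: seg; move: bnd; rewrite ler_norml => /andP[b1 b2].
  by rewrite ler_pdivlMr ?ler_pdivrMr; [apply/andP; split; nra| lra|lra].
have tb : 0 <= t <= 1 by rewrite t0 /=; lra.
have := cK _ _ t K3 Kk tb; congr K; apply: complexP.
  by rewrite !cE /=; field; lra.
by rewrite !cE /= !(mul0r, mulr0, addr0, add0r) /t mulfVK.
Qed.

(** Without a supporting line at p, the translate [T] of K by -p meets every open half-plane bounded
    by a line through 0. It then has points on both real half-axes and on both sides of the axis,
    and two half-discs make 0 an interior point. *)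
Lemma supporting_line K p : convexC K ->
  (forall e, 0 < e -> exists2 q, ~ K q & sqn (p - q) < e ^+ 2) ->
  exists2 w, sqn w = 1 & forall q, K q -> Re (w * (q - p)) <= 0.
Proof.
move=> cK pint.
have [[w w0 hw]|nosep] := pselect (exists2 w, w != 0 &
    forall q, K q -> Re (w * (q - p)) <= 0).
  have n0 : 0 < sqn w.
    by rewrite lt_neqAle sqn_ge0 andbT; apply: contra_neq w0 => /esym/sqn_eq0.
  pose c := (Num.sqrt (sqn w))^-1.
  have c0 : 0 < c by rewrite invr_gt0 sqrtr_gt0.
  exists (c%:C * w).
    have -> : sqn (c%:C * w) = c ^+ 2 * sqn w by rewrite /sqn !cE /=; ring.
    by rewrite exprVn sqr_sqrtr ?(ltW n0) // mulVf // gt_eqF.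
  move=> q /hw; rewrite !cE /= => h.
  have : c * (Re w * (Re q - Re p) - Im w * (Im q - Im p)) <= 0.
    by rewrite pmulr_rle0.
  by lra.
exfalso.
pose T := [set z | K (z + p)].
have cT : convexC T.
  move=> x y t Tx Ty tb; have := cK _ _ t Tx Ty tb; congr K.
  by rewrite rmorphB rmorph1; ring.
have sep w : w != 0 -> exists2 z, T z & 0 < Re (w * z).
  move=> w0; apply: contrapT => h; apply: nosep; exists w => // q Kq.
  rewrite leNgt; apply/negP => hq; apply: h; exists (q - p) => //.
  by rewrite /T /= subrK.
have [k3 Tk3 k3p] : exists2 z, T z & 0 < Im z.
  have [|z Tz] := sep (Complex 0 (-1)).
    by apply/eqP => -[/eqP]; rewrite oppr_eq0 oner_eq0.
  by rewrite !cE /= => h; exists z => //; lra.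
have [k4 Tk4 k4n] : exists2 z, T z & Im z < 0.
  have [|z Tz] := sep (Complex 0 1).
    by apply/eqP => -[/eqP]; rewrite oner_eq0.
  by rewrite !cE /= => h; exists z => //; lra.
have [r2 r20 T2] : exists2 r, r < 0 & T r%:C.
  have [//|[s hs]] := half_separation cT Tk3 k3p Tk4 k4n.
  have [|z Tz] := sep (Complex (-1) (- s)).
    by apply/eqP => -[/eqP]; rewrite oppr_eq0 oner_eq0.
  by rewrite !cE /= => h; have := hs z Tz; lra.
have [r1 r10 T1] : exists2 r, 0 < r & T r%:C.
  (* Reflection in the imaginary axis reduces the positive half-axis to the negative one, which
     [half_separation] treats. *)
  pose M := [set z | T (Complex (- Re z) (Im z))].
  have cM : convexC M.
    move=> x y t Mx My tb; have := cT _ _ t Mx My tb; congr T.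
    by apply: complexP; rewrite !cE /=; ring.
  have M3 : M (Complex (- Re k3) (Im k3)) by rewrite /M /= opprK; case: (k3) Tk3.
  have M4 : M (Complex (- Re k4) (Im k4)) by rewrite /M /= opprK; case: (k4) Tk4.
  have [[r r0 Mr]|[s hs]] := half_separation cM M3 k3p M4 k4n.
    by exists (- r); [rewrite oppr_gt0 | exact: Mr].
  have [|z Tz] := sep (Complex 1 (- s)).
    by apply/eqP => -[/eqP]; rewrite oner_eq0.
  have := hs (Complex (- Re z) (Im z)); rewrite /M /= opprK !cE /= => h1 h2.
  have Tz' : T (Complex (Re z) (Im z)) by case: (z) Tz.
  by have := h1 Tz'; lra.
have [|e3 e30 h3] := wedge_interior cT Tk3 _ T1 r10 T2 r20; first by rewrite gt_eqF.
have [|e4 e40 h4] := wedge_interior cT Tk4 _ T1 r10 T2 r20; first by rewrite lt_eqF.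
have [|q nKq qp] := pint (Num.min e3 e4); first by rewrite lt_min e30.
apply: nKq; have -> : q = (q - p) + p by rewrite subrK.
have {qp} : sqn (q - p) < Num.min e3 e4 ^+ 2 by rewrite -opprB sqnN.
rewrite -/(T (q - p)) => qe.
have m0 : 0 < Num.min e3 e4 by rewrite lt_min e30.
have [z0|z0] := leP 0 (Im (q - p)).
  apply: h3; last by rewrite mulr_ge0 // ltW.
  by apply: lt_le_trans qe _; rewrite lerXn2r ?nnegrE ?(ltW m0) ?(ltW e30) // ge_min lexx.
apply: h4; last by rewrite mulr_le0 // ltW.
by apply: lt_le_trans qe _; rewrite lerXn2r ?nnegrE ?(ltW m0) ?(ltW e40) // ge_min lexx orbT.
Qed.
End SupportingLine.

Section ToeplitzHausdorff.
Context {R : rcfType}.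

(* Along the real segment from x to e y, with the phase e chosen so that the
   cross terms become real, the Rayleigh quotient moves on the line through
   <Ax, x> and <Ay, y>; every intermediate value is taken. *)
Lemma numerical_range_convex n (A : 'M[R[i]]_n) : convexC (numerical_range A).
Proof.
move=> _ _ t [x /= /cnorm1P x1 <-] [y /= /cnorm1P y1 <-] /andP[t0 t1].
pose F u v := cdot (A *m u) v.
rewrite -[cdot (A *m x) x]/(F x x) -[cdot (A *m y) y]/(F y y).
have FE u v : F u v = cdot (A *m u) v by [].
have FDl u v w : F (u + v) w = F u w + F v w by rewrite /F mulmxDr cdotDl.
have FDr u v w : F w (u + v) = F w u + F w v by rewrite /F cdotDr.
have FZl c u w : F (c *: u) w = c * F u w by rewrite /F -scalemxAr cdotZl.
have FZr c u w : F w (c *: u) = c^* * F w u by rewrite /F cdotZr.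
clearbody F.
have [PQ|PQ] := eqVneq (F y y) (F x x).
  exists x; first exact/cnorm1P.
  by rewrite PQ -FE; move: (F x x) => P; rewrite rmorphB rmorph1 /=; ring.
move: PQ; set P := F x x; set Q := F y y => PQ.
have PE : F x x = P by []. have QE : F y y = Q by [].
clearbody P Q; pose d := Q - P.
have d0 : d != 0 by rewrite subr_eq0.
have dE : Q = P + d by rewrite /d addrC subrK.
clearbody d.
(* Affine normalisation: [u] and [v] are the cross terms of (A - P) / d, whose values at x and y are
   0 and 1. *)
pose u := (F x y - P * cdot x y) / d.
pose v := (F y x - P * cdot y x) / d.
have uE : F x y = P * cdot x y + d * u by rewrite /u [d * _]mulrC divfK // addrC subrK.
have vE : F y x = P * cdot y x + d * v by rewrite /v [d * _]mulrC divfK // addrC subrK.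
clearbody u v; pose W := u - v^*; have WE : W = u - v^* by [].
clearbody W.
(* The sum e^* u + e v is real exactly when e^* W is, so [e] is taken to be the phase of [W]. *)
have [e e1 eW] : exists2 e : R[i], e * e^* = 1 & e^* * W = (e^* * W)^*.
  have [->|W0] := eqVneq W 0; first by exists 1; rewrite ?mulr0 ?rmorph1 ?mulr1 ?rmorph0.
  exists (W / `|W|).
    rewrite rmorphM /= fmorphV /= conj_normC mulrACA -normCK -[_^-1 * _]expr2.
    by rewrite -exprMn mulfV ?expr1n // normr_eq0.
  rewrite rmorphM /= rmorphM /= fmorphV /= conj_normC.
  by rewrite !rmorphM /= fmorphV /= conj_normC conjCK; ring.
pose k := Re (e^* * u + e * v).
have kE : e^* * u + e * v = k%:C.
  apply: complexP; rewrite // /k /=.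
  have := congr1 (@complex.Im R) eW; rewrite WE !cE => {}eW; rewrite /= in eW *; lra.
pose r := Re (e^* * cdot x y + e * cdot y x).
have rE : e^* * cdot x y + e * cdot y x = r%:C.
  by apply: complexP; rewrite // /r /= [cdot y x]cdotC !cE; lra.
clearbody k r.
pose z (s : R) := (1 - s)%:C *: x + s%:C *: (e *: y).
pose N (s : R) := (1 - s) ^+ 2 + s ^+ 2 + s * (1 - s) * r.
have conjR (s : R) : (s%:C)^* = s%:C :> R[i] by exact: conjc_real.
have Nz s : cdot (z s) (z s) = (N s)%:C.
  rewrite /z /N !(cdotDl, cdotDr, cdotZl, cdotZr) x1 y1 !conjR.
  set s' := 1 - s; clearbody s'; rewrite !expr2 !(rmorphD, rmorphM) /= -rE.
  have -> : s%:C * s%:C = s%:C * s%:C * (e * e^*) by rewrite e1 mulr1.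
  move: (s%:C) (s'%:C) (e^*) => {}s {}s' e'; ring.
have Fz s : F (z s) (z s) = P * (N s)%:C + d * (s ^+ 2 + s * (1 - s) * k)%:C.
  rewrite -Nz /z !(FDl, FDr, FZl, FZr, cdotDl, cdotDr, cdotZl, cdotZr) x1 y1 !conjR.
  set s' := 1 - s; clearbody s'; rewrite !expr2 !(rmorphD, rmorphM) /= -kE.
  have -> : s%:C * s%:C = s%:C * s%:C * (e * e^*) by rewrite e1 mulr1.
  rewrite PE QE dE uE vE; move: (s%:C) (s'%:C) (e^*) => {}s {}s' e'; ring.
(* At a root [s] the quotient at [z s] is P + t d; a root in [0, 1] exists because p(0) = -t <= 0 <=
   1 - t = p(1). *)
pose p : {poly R} := (1 - k - t * (2 - r)) *: 'X^2 + (k - t * (r - 2)) *: 'X - t%:P.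
have pE s : p.[s] = s ^+ 2 + s * (1 - s) * k - t * N s.
  by rewrite /p /N hornerD hornerN hornerC hornerD !hornerZ hornerX hornerXn; ring.
have [|s /andP[s0 s1] /rootP ps] := @poly_ivt R p 0 1 ler01.
  by rewrite !pE /N; apply/andP; split; lra.
have Fs : F (z s) (z s) = (P + d * t%:C) * (N s)%:C.
  have : s ^+ 2 + s * (1 - s) * k = t * N s by move: ps; rewrite pE; lra.
  by rewrite Fz => ->; move: (N s) => N'; rewrite rmorphM /=; ring.
have N_ge0 : 0 <= N s by have := cdot_ge0 (z s); rewrite Nz ler0c.
(* Otherwise z s = 0, so x is a unimodular multiple of y and the two values P and Q coincide. *)
have N_neq0 : N s != 0.
  apply: contraNneq PQ => N0.
  have : z s = 0 by apply: cdot_eq0; rewrite Nz N0.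
  move=> /eqP; rewrite /z addr_eq0 -scalerN => /eqP zs.
  have : cdot ((1 - s)%:C *: x) ((1 - s)%:C *: x)
       = cdot (s%:C *: (e *: y)) (s%:C *: (e *: y)).
    by rewrite zs scalerN -scaleNr !(cdotZl, cdotZr) rmorphN; ring.
  rewrite !(cdotZl, cdotZr) x1 y1 !conjR => h.
  have {}h : (1 - s)%:C * (1 - s)%:C = s%:C * s%:C.
    transitivity (s%:C * s%:C * (e * e^*)); last by rewrite e1 mulr1.
    move: h; rewrite !mulr1; set s' := (1 - s)%:C; clearbody s' => ->; ring.
  have {h} s12 : 1 - s = s.
    have : (1 - s) * (1 - s) = s * s by apply: (@complexI R); rewrite !rmorphM.
    by nra.
  have sC : s%:C != 0 :> R[i].
    rewrite fmorph_eq0; apply: contra_eq_neq s12 => ->.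
    by rewrite subr0 oner_eq0.
  have {zs}xy : x = - (e *: y) by apply: (scalerI sC); rewrite -zs s12.
  by rewrite -PE -QE xy -scaleNr FZl FZr mulrA rmorphN /= mulrNN e1 mul1r.
pose c : R[i] := ((Num.sqrt (N s))^-1)%:C.
have cc : c * c^* * (N s)%:C = 1.
  rewrite /c conjR -!rmorphM /= -expr2 exprVn sqr_sqrtr // mulVf //.
exists (c *: z s).
  by apply/cnorm1P; rewrite cdotZl cdotZr Nz mulrA.
rewrite -FE FZl FZr Fs rmorphB rmorph1 /=.
transitivity ((P + d * t%:C) * (c * c^* * (N s)%:C)); first by ring.
by rewrite cc mulr1 dE; ring.
Qed.

End ToeplitzHausdorff.

(** * KMS matrices *)

Section Matrices.
Context {C : numClosedFieldType}.

Definition extend n (j : 'I_n) (y : 'cV[C]_n.-1) : 'cV[C]_n :=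
  \col_i oapp (fun k => y k 0) 0 (unlift j i).

Lemma extend_lift n (j : 'I_n) y k : extend j y (lift j k) 0 = y k 0.
Proof. by rewrite mxE liftK. Qed.

Lemma extend_at n (j : 'I_n) y : extend j y j 0 = 0.
Proof. by rewrite mxE unlift_none. Qed.

Lemma extendE n (j : 'I_n) (x : 'cV[C]_n) : x j 0 = 0 -> x = extend j (row' j x).
Proof.
move=> xj; apply/colP => i; case: (unliftP j i) => [k ->|->].
  by rewrite extend_lift mxE.
by rewrite extend_at.
Qed.

Lemma cdot_extend n (j : 'I_n) (A : 'M[C]_n) y :
  cdot (A *m extend j y) (extend j y) = cdot (principal_submx A j *m y) y.
Proof.
rewrite !cdotE (bigD1_ord j) //= extend_at rmorph0 mulr0 add0r.
apply: eq_bigr => i _; rewrite extend_lift; congr (_ * _).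
rewrite !mxE (bigD1_ord j) //= extend_at mulr0 add0r.
by apply: eq_bigr => k _; rewrite extend_lift !mxE.
Qed.

Lemma cdot_extend1 n (j : 'I_n) (y : 'cV[C]_n.-1) :
  cdot (extend j y) (extend j y) = cdot y y.
Proof.
rewrite !cdot_sqE (bigD1_ord j) //= extend_at normr0 expr0n add0r.
by apply: eq_bigr => i _; rewrite extend_lift.
Qed.

Lemma numerical_range_principal n (j : 'I_n) (A : 'M[C]_n) p :
  numerical_range (principal_submx A j) p <->
  exists x : 'cV[C]_n, [/\ x j 0 = 0, cdot x x = 1 & cdot (A *m x) x = p].
Proof.
split=> [[y /= /cnorm1P y1 <-]|[x [xj x1 <-]]].
  by exists (extend j y); rewrite extend_at cdot_extend1 cdot_extend.
move: x1; rewrite (extendE xj) cdot_extend1 cdot_extend => x1.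
by exists (row' j x) => //=; apply/cnorm1P.
Qed.

Lemma phase_unit (a : C) : a != 0 -> (a^* / `|a|)^* * (a^* / `|a|) = 1.
Proof.
move=> a0; rewrite mulrC -normCK normrM normfV norm_conjC normr_id.
by rewrite mulfV ?expr1n // normr_eq0.
Qed.

Lemma phase_mx_unitary n (a : C) : a != 0 ->
  (phase_mx n a)^t* *m phase_mx n a = 1%:M.
Proof.
move=> a0; rewrite /phase_mx tr_diag_mx map_diag_mx mulmx_diag -diag_const_mx.
congr diag_mx; apply/rowP => k; rewrite !mxE.
by rewrite rmorphXn -exprMn /= phase_unit // expr1n.
Qed.

(** With u = a^* / |a| and v its conjugate, entry (i, j) on the right is u^i |a|^(j-i) v^j = (|a|
    v)^(j-i), and |a| v = a. *)
Lemma KMS_phase n (a : C) : a != 0 ->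
  KMS n a = phase_mx n a *m KMS n `|a| *m (phase_mx n a)^t*.
Proof.
move=> a0; rewrite /phase_mx tr_diag_mx map_diag_mx.
apply/matrixP => i j; rewrite mul_mx_diag mul_diag_mx !mxE.
case: ifP => [ij|_]; last by rewrite mulr0 mul0r.
have aE : `|a| * (a^* / `|a|)^* = a.
  by rewrite rmorphM /= conjCK fmorphV /= conj_normC mulrC divfK ?normr_eq0.
have -> : (j : nat) = (i + (j - i))%N by rewrite subnKC // ltnW.
rewrite addKn rmorphXn /= -[X in X ^+ _ = _]aE; set u := a^* / `|a|.
have uu : u ^+ i * u^* ^+ i = 1 by rewrite -exprMn mulrC phase_unit ?expr1n.
rewrite exprMn exprD -[LHS]mul1r -uu.
by move: (u^*) => u'; ring.
Qed.

Lemma cdot_phase n (a : C) (x : 'cV[C]_n) : a != 0 ->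
  cdot (phase_mx n a *m x) (phase_mx n a *m x) = cdot x x.
Proof. by move=> a0; rewrite cdot_adj mulmxA phase_mx_unitary // mul1mx. Qed.

Lemma cdot_KMS_phase n (a : C) (x : 'cV[C]_n) : a != 0 ->
  cdot (KMS n a *m (phase_mx n a *m x)) (phase_mx n a *m x)
    = cdot (KMS n `|a| *m x) x.
Proof.
move=> a0; rewrite {1}KMS_phase // -!mulmxA (mulmxA _ _ x) phase_mx_unitary //.
by rewrite mul1mx cdot_adj mulmxA phase_mx_unitary // mul1mx.
Qed.

End Matrices.

(** * From column vectors to sequences *)

Section Link.
Context {R : rcfType}.
Implicit Types (f : nat -> R[i]).

Definition coords n (x : 'cV[R[i]]_n) : nat -> R[i] :=
  fun k => oapp (fun i => x i 0) 0 (insub k).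

Lemma coordsE n (x : 'cV[R[i]]_n) (i : 'I_n) : coords x i = x i 0.
Proof. by rewrite /coords valK. Qed.

Lemma col_coords n (x : 'cV[R[i]]_n) : x = \col_i coords x i.
Proof. by apply/colP => i; rewrite mxE coordsE. Qed.

Lemma cdot_col n f : cdot (\col_(i < n) f i) (\col_(i < n) f i) = (sqnorm n f)%:C.
Proof.
rewrite cdot_sqE /sqnorm rmorph_sum; apply: eq_bigr => i _.
by rewrite mxE -add_Re2_Im2.
Qed.

Lemma cdot_KMS n (r : R) f :
  cdot (KMS n r%:C *m \col_(i < n) f i) (\col_(i < n) f i) = kms_form r n f.
Proof.
rewrite cdotE /kms_form.
under eq_bigr => i _ do rewrite !mxE mulr_suml.
rewrite exchange_big; apply: eq_bigr => k _ /=.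
rewrite /left_sum (big_ord_widen n (fun i => (r ^+ (k - i))%:C * f i)); last exact/ltnW.
rewrite rmorph_sum mulr_sumr [RHS]big_mkcond /=; apply: eq_bigr => i _.
rewrite !mxE; case: ifP => _; last by rewrite !mul0r.
by rewrite rmorphM /= conj_realC rmorphXn /=; ring.
Qed.


(** On (u, 0, -u) the two arms contribute conjugate values and the coupling term is - |s|^2. *)
Lemma form_odd_real (a : R) l f : f l = 0 ->
  (forall k, (k < l)%N -> f (l + k.+1)%N = - f (l - k.+1)%N) ->
  Im (kms_form a (l + l.+1) f) = 0.
Proof.
move=> fl odd; rewrite (eq_form a (@arms_split _ l l f)) form_arms fl.
have oddE s : (s < l)%N -> f (l + s.+1)%N = -1 * mirror l f s.
  by move=> sl; rewrite odd // mulN1r.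
rewrite (eq_form a oddE) (eq_right_sum a oddE) formZ right_sumZ /sqn !cE /=; ring.
Qed.

Lemma sqnorm_normalize n f : (exists2 k, (k < n)%N & f k != 0) ->
  exists c : R, sqnorm n (fun k => c%:C * f k) = 1.
Proof.
move=> [k kn fk]; have m0 := sqnorm_ge0 n f; exists (Num.sqrt (sqnorm n f))^-1.
rewrite sqnormZ /sqn /= expr0n addr0 exprVn sqr_sqrtr // mulVf //.
by apply: contra_neq fk => /sqnorm_eq0 ->.
Qed.

Lemma defect_ge0 (a lam : R) w n : (forall f, sqnorm n f = 1 -> 0 <= defect a lam w n f) ->
  forall f, 0 <= defect a lam w n f.
Proof.
move=> h f; have m0 := sqnorm_ge0 n f.
have [[k kn fk]|f0] := pselect (exists2 k, (k < n)%N & f k != 0); last first.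
  have {}f0 k : (k < n)%N -> f k = 0.
    by move=> kn; apply: contrapT => /eqP fk; apply: f0; exists k.
  have := @defectZ _ a lam w n f 0; rewrite sqn0 mul0r => <-.
  by rewrite (@eq_defect _ _ _ _ _ _ f) // => k kn; rewrite f0 // mulr0.
have [c m1] : exists c : R, sqnorm n (fun k => c%:C * f k) = 1.
  by apply: sqnorm_normalize; exists k.
have := h _ m1; rewrite defectZ pmulr_rge0 // lt_neqAle sqn_ge0 andbT eq_sym.
by apply: contra_eq_neq m1; rewrite sqnormZ => ->; rewrite mul0r eq_sym oner_eq0.
Qed.

End Link.

(** * Common boundary points and the least eigenvalue of the real part *)

Section Main.
Context {R : realType}.
Context (n : nat) (a : R[i]) (r : R) (j : 'I_n).
Context (n2 : (2 <= n)%N) (ar : `|a| = r%:C) (r0 : 0 < r) (r1 : r != 1).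

Local Notation J := (KMS n a).
Local Notation D := (phase_mx n a).

Let a0 : a != 0.
Proof. by rewrite -normr_gt0 ar ltcR. Qed.

(** In the coordinates [f] the matrix J becomes the KMS matrix of the real parameter [r]. *)
Definition vect (f : nat -> R[i]) : 'cV[R[i]]_n := D *m \col_i f i.

Lemma cdot_vect f : cdot (vect f) (vect f) = (sqnorm n f)%:C.
Proof. by rewrite cdot_phase // cdot_col. Qed.

Lemma form_vect f : cdot (J *m vect f) (vect f) = kms_form r n f.
Proof. by rewrite cdot_KMS_phase // ar cdot_KMS. Qed.

Lemma vect_entry f (i : 'I_n) : vect f i 0 = (a^* / `|a|) ^+ i * f i.
Proof. by rewrite /vect /phase_mx mul_diag_mx !mxE. Qed.

Lemma vectP x : exists f, x = vect f.
Proof.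
exists (coords ((D^t*) *m x)); rewrite /vect -col_coords mulmxA.
suff -> : D *m D^t* = 1%:M by rewrite mul1mx.
by apply: mulmx1C; apply: phase_mx_unitary.
Qed.

Lemma form_in_range f : sqnorm n f = 1 -> numerical_range J (kms_form r n f).
Proof.
move=> f1; exists (vect f); last exact: form_vect.
by apply/cnorm1P; rewrite cdot_vect f1.
Qed.

Lemma principal_range_form p : numerical_range (principal_submx J j) p <->
  exists f : nat -> R[i], [/\ f j = 0, sqnorm n f = 1 & kms_form r n f = p].
Proof.
have u0 : (a^* / `|a|) ^+ j != 0.
  by rewrite expf_neq0 // mulf_neq0 ?conjC_eq0 ?invr_eq0 ?normr_eq0.
rewrite numerical_range_principal; split=> [[x [xj x1 <-]]|[f [fj f1 <-]]].
  have [f fE] := vectP x; exists f; split.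
  - move: xj; rewrite fE vect_entry => /eqP.
    by rewrite mulf_eq0 (negPf u0) => /eqP.
  - by apply: (@complexI R); rewrite -cdot_vect -fE x1.
  - by rewrite -form_vect -fE.
by exists (vect f); rewrite vect_entry fj mulr0 cdot_vect f1 form_vect.
Qed.

Lemma j_split : exists2 l, n = (j + l.+1)%N & (0 < j + l)%N.
Proof.
have jn := ltn_ord j; exists (n - j.+1)%N; last by move: n2; lia.
by rewrite -addSnnS subnKC.
Qed.

(** The range of the submatrix is closed, so p is the form of a unit [f] vanishing at j. A
    supporting line of W(J) at p makes [f] a zero of S; w = -1 then says that this line is vertical
    with W(J) on its right. *)
Lemma inter_boundary p : boundary (numerical_range J) p ->
  boundary (numerical_range (principal_submx J j)) p ->
  [/\ numerical_range J p, n = (j + j.+1)%N, 1 < r, Im p = 0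
    & forall q, numerical_range J q -> Re p <= Re q].
Proof.
move=> /boundaryP[_ bJ] [clp _].
have /principal_range_form[f [fj f1 fp]] : numerical_range (principal_submx J j) p.
  exact: (numerical_range_closed complex_disc_compact).
have [w w1 hw] := supporting_line (@numerical_range_convex _ _ _) bJ.
pose lam := Re (w * p).
have pos : forall g, 0 <= defect r lam w n g.
  apply: defect_ge0 => g g1; rewrite /defect g1 mulr1 subr_ge0.
  by have := hw _ (form_in_range g1); rewrite /lam !cE; lra.
have D0 : defect r lam w n f = 0 by rewrite /defect f1 fp mulr1 subrr.
have [k kn fk] : exists2 k, (k < n)%N & f k != 0.
  apply: contrapT => h; have := f1; rewrite /sqnorm big1 => [/eqP|i _].
    by rewrite eq_sym oner_eq0.
  have [->|fi] := eqVneq (f i) 0; first exact: sqn0.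
  by case: h; exists i.
have [l nE jl] := j_split; rewrite nE in pos D0 kn.
have [wE lE r_gt1 odd] := @extremal_zero _ r lam r0 r1 w j l f w1 jl pos D0 fj
  (ex_intro2 _ _ k kn fk).
split=> //; first by rewrite -fp; apply: form_in_range.
- by rewrite {1}nE -lE.
- by rewrite -fp nE -lE; apply: form_odd_real => //; rewrite lE in odd *.
- by move=> q /hw; rewrite wE !cE /=; lra.
Qed.

Lemma boundary_min (S : set R[i]) (b : R[i]) :
  S b -> (forall q, S q -> Re b <= Re q) -> boundary S b.
Proof.
move=> Sb minb; apply/boundaryP; split=> e e0.
  by exists b => //; rewrite subrr sqn0 exprn_gt0.
exists (b - (e / 2)%:C).
  by move=> /minb; rewrite !cE /=; lra.
by rewrite opprB addrC subrK /sqn /= expr0n /= addr0; nra.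
Qed.

Section LeastEigenvalue.
Context (b : R[i]) (hb : is_min (spectrum (re_mx J)) b).

Lemma least_real : b = (Re b)%:C.
Proof. by have [/RRe_real ->] := re_mx_min hb. Qed.

Lemma least_le q : numerical_range J q -> Re b <= Re q.
Proof.
have [_ h _ _] := re_mx_min hb.
move=> [x /= /cnorm1P x1 <-]; have := h x.
by rewrite x1 mulr1 -complexRe {1}least_real lecR.
Qed.

(** For w = -1 and lam = -b the form S is that of Re J - b, in the coordinates of [vect]. *)
Lemma least_defect g : 0 <= defect r (- Re b) (-1) n g.
Proof.
have [_ h _ _] := re_mx_min hb.
have := h (vect g); rewrite cdot_vect form_vect -complexRe least_real -rmorphM lecR.
by rewrite /defect !cE /=; lra.
Qed.

Lemma least_vector : exists2 g, defect r (- Re b) (-1) n g = 0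
  & exists2 k, (k < n)%N & g k != 0.
Proof.
have [_ _ _ [x x0 hx]] := re_mx_min hb.
have [g gE] := vectP x; exists g.
  have := re_mxE J x; rewrite hx cdotZl gE cdot_vect form_vect -complexRe.
  rewrite {1}least_real -rmorphM => /complexI.
  by rewrite /defect !cE /=; lra.
apply: contrapT => h; move/eqP: x0; apply; rewrite gE.
apply/colP => i; rewrite vect_entry mxE.
have [->|gi] := eqVneq (g i) 0; first by rewrite mulr0.
by case: h; exists i.
Qed.

(** [extremal_odd] turns a least eigenvector into one with middle entry 0, and [extremal_zero] shows
    that one to be skew. Skewness makes its form real, hence equal to [b] after normalisation. *)
Lemma least_odd_vector : n = (j + j.+1)%N -> 1 < r ->
  exists f : nat -> R[i], [/\ f j = 0, sqnorm n f = 1, kms_form r n f = b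
    & forall k, (k < j)%N -> f (j + k.+1)%N = - f (j - k.+1)%N].
Proof.
move=> nE r_gt1; have [g g0 gn0] := least_vector.
have pos := least_defect; rewrite nE in g0 gn0 pos.
have j0 : (0 < j)%N by move: n2 nE; lia.
have [y [y0 yj yn0]] := extremal_odd r0 r1 r_gt1 j0 pos g0 gn0.
have sqnN1 : sqn (-1 : R[i]) = 1 by rewrite /sqn !cE /=; ring.
have [_ _ _ odd] := extremal_zero r0 r1 sqnN1 (ltn_addr _ j0) pos y0 yj yn0.
have [c m1] : exists c : R, sqnorm n (fun k => c%:C * y k) = 1.
  by apply: sqnorm_normalize; rewrite {1}nE.
exists (fun k => c%:C * y k).
have cond : forall k, (k < j)%N ->
    c%:C * y (j + k.+1)%N = - (c%:C * y (j - k.+1)%N).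
  by move=> k kj; rewrite odd // mulrN.
have cj : c%:C * y j = 0 by rewrite yj mulr0.
split=> //.
apply: complexP.
  have := defectZ r (- Re b) (-1) n y c%:C.
  by rewrite {2}nE y0 mulr0 /defect m1 !cE /=; lra.
by rewrite [in RHS]least_real nE; apply: (form_odd_real r cj cond).
Qed.

End LeastEigenvalue.

End Main.

(** Indices start at 0, so [l.+1] is the position (n + 1) / 2 counted from 1. *)
Lemma odd_middle n l : odd n && (l.+1 == n.+1./2) = (n == l + l.+1)%N.
Proof. lia. Qed.

Lemma rev_ord_middle n (j : 'I_n) : n = (j + j.+1)%N -> rev_ord j = j.
Proof. by move=> nE; apply: val_inj => /=; move: nE; lia. Qed.

Lemma rev_ord_reflect n (j i : 'I_n) : n = (j + j.+1)%N -> (i < j)%N ->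
  rev_ord i = (j + (j - i.+1).+1)%N :> nat /\ (j - (j - i.+1).+1 = i)%N.
Proof. by move=> /= nE ij; split; [move: nE|]; lia. Qed.

Lemma rev_ord_parity n (j i : 'I_n) : n = (j + j.+1)%N -> (i < j)%N ->
  rev_ord i = (i + (j - i).*2)%N :> nat.
Proof. by move=> /= nE ij; rewrite -addnn; move: nE; lia. Qed.

Theorem theorem3p8 (R : realType) (n : nat) (a b : R[i]) (j : 'I_n)
    (hn : (2 <= n)%N) (ha0 : `|a| != 0) (ha1 : `|a| != 1)
    (hb : is_min (spectrum (re_mx (KMS n a))) b) :
  let J := KMS n a in
  let I := boundary (numerical_range J)
             `&` boundary (numerical_range (principal_submx J j)) in
  [/\ I = (if [&& odd n, j.+1 == n.+1./2 & 1 < `|a|] then [set b] else set0),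
      I b -> exists y : 'cV[R[i]]_n,
        [/\ cnorm y = 1, skew_about j y,
            re_mx J *m (phase_mx n a *m y) = b *: (phase_mx n a *m y) &
            cdot (J *m (phase_mx n a *m y)) (phase_mx n a *m y) = b]
    & a \is Num.real -> I b -> exists x : 'cV[R[i]]_n,
        [/\ cnorm x = 1, skew_about j x,
            re_mx J *m x = b *: x & cdot (J *m x) x = b]].
Proof.
move=> J I; have jn := ltn_ord j.
pose r := Re `|a|.
have ar : `|a| = r%:C by rewrite /r RRe_real // normr_real.
clearbody r.
have r0 : 0 < r.
  have : 0 < `|a| by rewrite lt_neqAle eq_sym ha0 normr_ge0.
  by rewrite ar ltcR.
have r1 : r != 1 by apply: contra_neq ha1; rewrite ar => ->.
have gt1 : (1 < `|a|) = (1 < r) by rewrite ar ltcR.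
have condE : [&& odd n, j.+1 == n.+1./2 & 1 < `|a|] = (n == j + j.+1)%N && (1 < r).
  rewrite gt1 andbA; congr (_ && _).
  exact: odd_middle.
have a0 : a != 0 by rewrite -normr_eq0.
have [_ _ reJ _] := re_mx_min hb.
(* A common boundary point is real and minimises the real part over W(J); a normalised least
   eigenvector attains the same minimum Re b. *)
have sub : I `<=` [set p | (n == j + j.+1)%N && (1 < r) /\ p = b].
  move=> p [/[dup] pJ h1 h2].
  have [pW nE r_gt1 Ip minp] := inter_boundary hn ar r0 r1 h1 h2.
  split; first by rewrite {1}nE eqxx.
  have [g g1 gp] : exists2 g, sqnorm n g = 1 & Re (kms_form r n g) = Re b.
    have [g g0 [k kn gk]] := least_vector ar r0 hb.
    have [c m1] : exists c : R, sqnorm n (fun k => c%:C * g k) = 1.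
      by apply: sqnorm_normalize; exists k.
    exists (fun k => c%:C * g k) => //.
    have := defectZ r (- Re b) (-1) n g c%:C.
    by rewrite g0 mulr0 /defect m1 !cE /=; lra.
  apply: complexP; last by rewrite Ip (least_real hb).
  apply/eqP; rewrite eq_le -{1}gp minp; last exact: (form_in_range ar).
  exact: (least_le hb).
have [/andP[/eqP nE r_gt1]|ncond] := boolP ((n == j + j.+1)%N && (1 < r)); last first.
  rewrite condE (negPf ncond); have I0 : I = set0.
    by apply/seteqP; split=> // p /sub [c]; rewrite c in ncond.
  by rewrite I0; split.
have [f [fj f1 fb odd_f]] := least_odd_vector hn ar r0 r1 hb nE r_gt1.
have Jb : numerical_range J b by rewrite -fb; apply: (form_in_range ar).
have sJ p : numerical_range (principal_submx J j) p -> numerical_range J p.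
  have [h _] := principal_range_form j ar r0 p; move=> /h[g [_ g1 <-]].
  exact: (form_in_range ar).
have Ib : I b.
  split; apply: boundary_min => //; first exact: least_le hb.
  - by have [_ h] := principal_range_form j ar r0 b; apply: h; exists f.
  - by move=> q /sJ; apply: least_le hb _.
have normy : cnorm (\col_i f i : 'cV[R[i]]_n) = 1.
  by apply/cnorm1P; rewrite cdot_col f1.
have revj : rev_ord j = j by apply: rev_ord_middle.
have skewf (i : 'I_n) : (i < j)%N -> f (rev_ord i) = - f i.
  move=> ij; have [-> e] := rev_ord_reflect nE ij.
  by rewrite odd_f ?e // ltn_subrL (leq_ltn_trans _ ij).
have ev : re_mx J *m vect n a f = b *: vect n a f.
  apply: reJ; rewrite (cdot_vect n ar r0) f1 mulr1 (form_vect n ar r0).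
  by rewrite fb -complexRe -(least_real hb).
have eb : cdot (J *m vect n a f) (vect n a f) = b by rewrite (form_vect n ar r0).
split.
- rewrite condE r_gt1 andbT -nE eqxx; apply/seteqP; split=> [p /sub[_ ->]//|p ->//].
- move=> _; exists (\col_i f i); split=> //; split=> //; first by rewrite mxE.
  by move=> i ij; rewrite !mxE skewf.
move=> areal _; exists (vect n a f); split; [| |exact: ev|exact: eb].
  by apply/cnorm1P; rewrite (cdot_vect n ar r0) f1.
split; [exact: revj|by rewrite vect_entry fj mulr0|].
move=> i ij; rewrite !vect_entry skewf // mulrN; congr (- (_ * _)).
(* Mirrored positions differ by an even number and for real [a] the phase squares to 1, so both
   entries carry the same sign and skewness survives. *)
have [k ->] : exists k, rev_ord i = (i + k.*2)%N :> nat.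
  by exists (j - i)%N; apply: rev_ord_parity.
have ph2 : (a^* / `|a|) ^+ 2 = 1.
  by rewrite conj_Creal // exprMn exprVn real_normK // mulfV // expf_neq0.
by rewrite exprD -mul2n exprM ph2 expr1n mulr1.
Qed.
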